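(* Let $\mathscr{G} = (\mathscr{V}, \mathscr{E})$ be a finite connected graph, let $\Delta \subset \mathbb{R}^d$ be a bounded convex subset, let $\|\cdot\|$ be a norm on $\mathbb{R}^d$, and let $\tau > 0$ and $\mu \in (0, 1/2]$. Let $(\xi_t)_{t \geq 0}$ be the multivariate Deffuant model on $\mathscr{G}$ with opinion space $\Delta$, norm $\|\cdot\|$, confidence threshold $\tau$ and convergence parameter $\mu$, started from independent and identically distributed initial opinions $\xi_0(x)$, $x \in \mathscr{V}$, each distributed as a $\Delta$-valued random variable $X$. Let $\mathbf{d} = \sup_{a, b \in \Delta} \|a - b\|$ be the diameter of $\Delta$, and let $\mathbf{c} \in \Delta$ be a center of $\Delta$, that is, a point of $\Delta$ such that $\sup_{a \in \Delta} \|a - \mathbf{c}\| = \mathbf{d}/2$. Then, for all $\tau > \mathbf{d}/2$, $$ P(\mathscr{C}) \geq 1 - \frac{E\,\|X - \mathbf{c}\|}{\tau - \mathbf{d}/2} \quad \text{where} \quad \mathscr{C} = \Big\{ \lim_{t \to \infty} \, \sup_{x, y \in \mathscr{V}} \, \|\xi_t(x) - \xi_t(y)\| = 0 \Big\}. $$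
   Context: The multivariate Deffuant model is the continuous-time Markov chain $(\xi_t)_{t \geq 0}$ whose state at time $t$ is a configuration $\xi_t : \mathscr{V} \to \Delta$, where $\xi_t(x)$ is the opinion at vertex $x$ at time $t$. The edges of $\mathscr{G}$ become independently active at rate one (i.e., at the times of independent rate-one Poisson processes, independent of the initial configuration; almost surely no two edges become active simultaneously). If edge $(x, y) \in \mathscr{E}$ is active at time $t$, then $$ \xi_t(x) = \xi_{t-}(x) + \mu\,(\xi_{t-}(y) - \xi_{t-}(x))\,\mathbf{1}\{\|\xi_{t-}(x) - \xi_{t-}(y)\| \leq \tau\}, $$ $$ \xi_t(y) = \xi_{t-}(y) + \mu\,(\xi_{t-}(x) - \xi_{t-}(y))\,\mathbf{1}\{\|\xi_{t-}(x) - \xi_{t-}(y)\| \leq \tau\}, $$ while the opinions at the other vertices remain unchanged. Here $\xi_{t-}$ is the configuration just before time $t$. *)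

(* Defs.v *)
From HB Require Import structures.
From mathcomp Require Import all_boot all_order all_algebra.
From mathcomp Require Import finmap.
From mathcomp Require Import all_classical all_reals all_analysis.

Set Implicit Arguments.
Unset Strict Implicit.
Unset Printing Implicit Defensive.
Import Order.TTheory GRing.Theory Num.Theory.
Import numFieldTopology.Exports numFieldNormedType.Exports.

Local Open Scope classical_set_scope.
Local Open Scope ring_scope.

Notation borel_rV R d := (g_sigma_algebraType (@open 'rV[R]_d)).

Record is_norm (R : realType) (d : nat) (nrm : 'rV[R]_d -> R) : Prop := {
  is_norm_triangle : forall u v, nrm (u + v) <= nrm u + nrm v ;
  is_norm_scale : forall (k : R) u, nrm (k *: u) = `|k| * nrm u ;
  is_norm_definite : forall u, nrm u = 0 -> u = 0 }.

Definition diameter (R : realType) (d : nat) (nrm : 'rV[R]_d -> R)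
    (Delta : set 'rV[R]_d) : R :=
  sup [set nrm (a - b) | a in Delta & b in Delta].

Definition is_center (R : realType) (d : nat) (nrm : 'rV[R]_d -> R)
    (Delta : set 'rV[R]_d) (c : 'rV[R]_d) : Prop :=
  Delta c /\ sup [set nrm (a - c) | a in Delta] = diameter nrm Delta / 2.

(* A graph on V is given by its set E of edges, which are unordered pairs. *)
Definition simple_graph (V : finType) (E : {set {set V}}) : Prop :=
  forall a, a \in E -> #|a| = 2%N.

Definition connected_graph (V : finType) (E : {set {set V}}) : Prop :=
  forall x y : V, connect (fun u v : V => [set u; v]%SET \in E) x y.

Section probability_notions.
Context (R : realType) (disp : measure_display) (T : measurableType disp).
Variable P : probability T R.

Definition sigma_generated (I : Type) (D : set I) (disp' : measure_display)
    (S : measurableType disp') (f : I -> T -> S) : set (set T) :=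
  <<s \bigcup_(i in D) g_sigma_algebra_preimage (f i) >>.

Definition mutually_independent (I : choiceType) (D : set I)
    (F : I -> set (set T)) : Prop :=
  forall (J : {fset I}) (A : I -> set T), [set` J] `<=` D ->
    (forall i, i \in J -> F i (A i)) ->
    P (\bigcap_(i in [set` J]) A i) = (\prod_(i <- J) P (A i))%E.

Definition independent (F G : set (set T)) : Prop :=
  forall A B, F A -> G B -> P (A `&` B) = (P A * P B)%E.

(* Only times t >= 0 are meaningful. In the increment law s < t is strict
   because poisson_pmf takes the value 1 at every k when its rate is 0. *)
Record poisson_process (lambda : R) (N : R -> T -> nat) : Prop := {
  poisson_process_measurable :
    forall t, 0 <= t -> measurable_fun setT (N t) ;
  poisson_process0 : forall w, N 0 w = 0%N ;
  poisson_process_nondecreasing :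
    forall w s t, 0 <= s -> s <= t -> (N s w <= N t w)%N ;
  poisson_process_right_continuous :
    forall w t, 0 <= t -> \forall s \near t^'+, N s w = N t w ;
  poisson_process_increment : forall s t k, 0 <= s -> s < t ->
    P [set w | (N t w - N s w)%N = k] = (poisson_pmf (lambda * (t - s)) k)%:E ;
  poisson_process_independent_increments : forall t : nat -> R,
    0 <= t 0%N -> {homo t : i j / (i <= j)%N >-> i <= j} ->
    mutually_independent setT (fun i : nat =>
      g_sigma_algebra_preimage (fun w => (N (t i.+1) w - N (t i) w)%N)) }.

End probability_notions.

Definition jump_time (R : realType) (n : R -> nat) (t : R) : Prop :=
  0 < t /\ forall s, 0 <= s -> s < t -> (n s < n t)%N.

Section deffuant.
Context (R : realType) (d : nat) (V : finType).
Variables (E : {set {set V}}) (Delta : set 'rV[R]_d) (nrm : 'rV[R]_d -> R).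
Variables (tau mu : R).

Definition deffuant_update (x y : V) (eta : V -> 'rV[R]_d) : V -> 'rV[R]_d :=
  let m := mu * (nrm (eta x - eta y) <= tau)%R%:R in
  fun z => if z == x then eta x + m *: (eta y - eta x)
           else if z == y then eta y + m *: (eta x - eta y)
           else eta z.

(* The dynamics along one trajectory, where n a counts the activations of the
   edge a; eta is the configuration just before time t. *)
Definition deffuant_path (n : {set V} -> R -> nat) (xi : R -> V -> 'rV[R]_d) :
    Prop :=
  forall t, 0 < t -> exists eta : V -> 'rV[R]_d,
    [/\ \forall s \near t^'-, xi s = eta,
        forall x y, [set x; y]%SET \in E -> jump_time (n [set x; y]%SET) t ->
          xi t = deffuant_update x y eta
      & (forall a, a \in E -> ~ jump_time (n a) t) -> xi t = eta].

(* N a is the clock of the edge a, and is irrelevant when a is not in E. The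
   dynamics is only required almost surely, because the updates required by
   two simultaneous activations may be incompatible; that the trajectories are
   right-continuous with values in Delta is required everywhere. *)
Record deffuant_model (disp : measure_display) (T : measurableType disp)
    (P : probability T R) (N : {set V} -> R -> T -> nat)
    (xi : R -> T -> V -> 'rV[R]_d) : Prop := {
  deffuant_clock : forall a, a \in E -> poisson_process P 1 (N a) ;
  deffuant_clocks_independent :
    mutually_independent P [set` E]
      (fun a => sigma_generated [set t | 0 <= t] (N a)) ;
  deffuant_initial_independent :
    independent P
      (sigma_generated setT (fun x w => xi 0 w x : borel_rV R d))
      (sigma_generated [set at_ : {set V} * R | at_.1 \in E /\ 0 <= at_.2]
        (fun at_ => N at_.1 at_.2)) ;
  deffuant_measurable : forall t x, 0 <= t ->
    measurable_fun setT (fun w => xi t w x : borel_rV R d) ;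
  deffuant_state : forall t w x, 0 <= t -> Delta (xi t w x) ;
  deffuant_right_continuous : forall t w, 0 <= t ->
    \forall s \near t^'+, xi s w = xi t w ;
  deffuant_dynamics :
    {ae P, forall w, deffuant_path (fun a t => N a t w) (fun t => xi t w)} }.

Definition consensus (T : Type) (xi : R -> T -> V -> 'rV[R]_d) : set T :=
  [set w | sup [set nrm (xi t w x - xi t w y) | x in setT & y in setT]
             @[t --> +oo] --> 0].

End deffuant.

(* The copies of X may live on a probability space other than that of X. *)
Definition iid_copies (R : realType) (d : nat) (V : finType)
    (disp : measure_display) (T : measurableType disp) (P : probability T R)
    (xi0 : T -> V -> 'rV[R]_d)
    (disp' : measure_display) (T' : measurableType disp')
    (Q : probability T' R) (X : T' -> 'rV[R]_d) : Prop :=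
  mutually_independent P setT (fun x : V =>
    g_sigma_algebra_preimage (fun w => xi0 w x : borel_rV R d)) /\
  forall (x : V) (B : set (borel_rV R d)), measurable B ->
    P [set w | B (xi0 w x)] = Q [set w | B (X w)].

(* Main.v *)
Require Import Defs.
From HB Require Import structures.
From mathcomp Require Import all_boot all_order all_algebra.
From mathcomp Require Import finmap ring lra.
From mathcomp Require Import all_classical all_reals all_analysis.
From mathcomp Require Import measurable_realfun.
Set Implicit Arguments.
Unset Strict Implicit.
Unset Printing Implicit Defensive.
Import Order.TTheory GRing.Theory Num.Theory.
Import numFieldTopology.Exports numFieldNormedType.Exports.

Local Open Scope classical_set_scope.
Local Open Scope ring_scope.

(* Along a trajectory the sum of the distances to the center c, the spread of
   the opinions and the energy, i.e. the sum of the squared coordinates, never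
   increase, since an update replaces two opinions by convex combinations of
   them.  An update of two opinions at distance more than e lowers the energy
   by a fixed amount.

   Given that the endpoints of an edge are at distance in ]e, tau] at time
   s = 1, 2, ..., this edge is with probability at least p > 0 the only one to
   ring in ]s, s + 1], where p does not depend on s, and then the energy drops.
   As the mean energy is bounded, the probability that at every integer time
   some edge has such a disagreement is 0.  Here one needs that the
   configuration at time s is independent of the rings after s: on a grid of
   mesh s / K it is a function of the initial configuration and of the set of
   edges ringing in each cell, unless two rings fall in one cell, which has
   probability O(1 / K).

   If the initial distances to c sum to less than |V| (tau - diam / 2), then at
   all times some vertex is closer than tau - diam / 2 to c, hence within tau of
   every opinion.  When no edge has a disagreement in ]e, tau], its neighbours
   are e-close to it, so also nearly as close to c, and so on along paths: all
   opinions are close to each other.  So consensus holds almost surely on this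
   event, whose complement is bounded by Markov's inequality. *)

(** * Norms and updates *)

Section norm.
Context (R : realType) (d : nat) (nrm : 'rV[R]_d -> R).
Hypothesis nrmP : is_norm nrm.

Lemma is_norm0 : nrm 0 = 0.
Proof. by rewrite -(scale0r 0) (is_norm_scale nrmP) normr0 mul0r. Qed.

Lemma is_normN u : nrm (- u) = nrm u.
Proof. by rewrite -scaleN1r (is_norm_scale nrmP) normrN1 mul1r. Qed.

Lemma is_norm_distC u v : nrm (u - v) = nrm (v - u).
Proof. by rewrite -is_normN opprB. Qed.

Lemma is_norm_ge0 u : 0 <= nrm u.
Proof.
have := is_norm_triangle nrmP u (- u).
by rewrite subrr is_norm0 is_normN; lra.
Qed.

Lemma is_norm_dist_trans u v w : nrm (u - w) <= nrm (u - v) + nrm (v - w).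
Proof. by have := is_norm_triangle nrmP (u - v) (v - w); rewrite addrA subrK. Qed.

Lemma is_norm_convex m u v p : 0 <= m <= 1 ->
  nrm (u + m *: (v - u) - p) <= (1 - m) * nrm (u - p) + m * nrm (v - p).
Proof.
move=> /andP[m0 m1].
have -> : u + m *: (v - u) - p = (1 - m) *: (u - p) + m *: (v - p).
  by apply/rowP => i; rewrite !mxE; ring.
apply: le_trans (is_norm_triangle nrmP _ _) _.
rewrite !(is_norm_scale nrmP) !ger0_norm//; lra.
Qed.

(** Triangle inequality in the standard basis. The summand 1 keeps [C] positive also when [d] is
    0. *)
Lemma is_norm_le_l1 :
  exists2 C, 0 < C & forall v, nrm v <= C * \sum_i `|v 0 i|.
Proof.
exists (1 + \sum_i nrm (delta_mx 0 i)).
  rewrite ltr_pwDl//; apply: sumr_ge0 => i _; exact: is_norm_ge0.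
move=> v; rewrite {1}(row_sum_delta v) mulr_sumr.
have nrm_sum (f : 'I_d -> 'rV[R]_d) : nrm (\sum_i f i) <= \sum_i nrm (f i).
  elim/big_ind2 : _ => [|a b a' b' ab ab'|//]; first by rewrite is_norm0.
  by apply: le_trans (is_norm_triangle nrmP _ _) _; exact: lerD.
apply: le_trans (nrm_sum _) _; apply: ler_sum => i _.
rewrite (is_norm_scale nrmP) mulrC ler_wpM2r//.
rewrite (bigD1 i)//= addrCA lerDl addr_ge0//.
by apply: sumr_ge0 => j _; exact: is_norm_ge0.
Qed.

(** If the squares sum to less than [k], every coordinate is at most e / (C (d + 1)), so the norm is
    at most e d / (d + 1) < e. Taking d + 1 makes this strict and covers d = 0. *)
Lemma is_norm_sqr_lower_bound e : 0 < e ->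
  exists2 k, 0 < k & forall v, e <= nrm v -> k <= \sum_i v 0 i ^+ 2.
Proof.
move=> e0; have [C C0 hC] := is_norm_le_l1.
have D0 : 0 < C * d.+1%:R by rewrite mulr_gt0.
exists ((e / (C * d.+1%:R)) ^+ 2); first by rewrite exprn_gt0// divr_gt0.
move=> v ev; rewrite leNgt; apply/negP => vk.
have vi i : `|v 0 i| <= e / (C * d.+1%:R).
  rewrite -(@ler_pXn2r _ 2)// ?nnegrE ?divr_ge0 ?(ltW e0) ?(ltW D0)//.
  rewrite real_normK ?num_real//; apply: le_trans (ltW vk).
  by rewrite (bigD1 i)//= lerDl sumr_ge0// => j _; rewrite sqr_ge0.
have : nrm v <= C * (d%:R * (e / (C * d.+1%:R))).
  apply: le_trans (hC v) _; rewrite ler_pM2l//.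
  apply: le_trans (ler_sum _ (fun i _ => vi i)) _.
  by rewrite sumr_const card_ord mulr_natl.
have -> : C * (d%:R * (e / (C * d.+1%:R))) = e * (d%:R / d.+1%:R).
  by rewrite -natr1; field; rewrite natr1 pnatr_eq0 lt0r_neq0.
have dd : d%:R / d.+1%:R < 1 :> R by rewrite ltr_pdivrMr// mul1r ltr_nat.
by apply/negP; rewrite -ltNge; apply: lt_le_trans ev; rewrite gtr_pMr.
Qed.

End norm.

Section update.
Context (R : realType) (d : nat) (V : finType) (nrm : 'rV[R]_d -> R).
Context (tau mu : R).
Hypotheses (nrmP : is_norm nrm) (mu0 : 0 < mu) (mu_half : mu <= 1 / 2).
Implicit Types (eta : V -> 'rV[R]_d) (x y : V).

Local Notation upd := (deffuant_update nrm tau mu).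

Definition spread_le (r : R) eta := forall x y, nrm (eta x - eta y) <= r.

(** Euclidean squares are used whatever [nrm] is: by their strict convexity every update that moves
    opinions lowers the sum. *)
Definition energy eta : R := \sum_x \sum_i (eta x 0 i) ^+ 2.

Lemma sum_deffuant_update (F : 'rV[R]_d -> R) x y eta : x != y ->
  \sum_z F (upd x y eta z) - \sum_z F (eta z) =
  F (upd x y eta x) + F (upd x y eta y) - (F (eta x) + F (eta y)).
Proof.
move=> xy; have split2 (G : V -> R) :
    \sum_z G z = G x + G y + \sum_(z | (z != x) && (z != y)) G z.
  by rewrite (bigD1 x)//= (bigD1 y) 1?eq_sym//= addrA.
rewrite (split2 (fun z => F (upd x y eta z))) (split2 (fun z => F (eta z))).
rewrite [X in _ + _ + X - _](eq_bigr (fun z => F (eta z))); first by ring.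
by move=> z /andP[zx zy]; rewrite /deffuant_update (negbTE zx) (negbTE zy).
Qed.

Let rate_itv (b : bool) : 0 <= mu * b%:R <= 1.
Proof.
move: mu0 mu_half => ? ?; apply/andP.
by case: b; rewrite /= ?mulr1 ?mulr0; split; lra.
Qed.

Lemma spread_le_update r x y eta : spread_le r eta -> spread_le r (upd x y eta).
Proof.
move=> sr; pose m := mu * (nrm (eta x - eta y) <= tau)%R%:R.
have m01 : 0 <= m <= 1 by exact: rate_itv.
have hull z : exists u v, upd x y eta z = eta u + m *: (eta v - eta u).
  rewrite /deffuant_update; case: eqP => _; first by exists x, y.
  case: eqP => _; first by exists y, x.
  by exists z, z; rewrite subrr scaler0 addr0.
have hull_le p z : (forall u, nrm (eta u - p) <= r) -> nrm (upd x y eta z - p) <= r.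
  move=> hp; have [u [v ->]] := hull z.
  apply: le_trans (is_norm_convex nrmP _ _ _ m01) _.
  have -> : r = (1 - m) * r + m * r by ring.
  by case/andP: m01 => m0 m1; rewrite lerD// ler_wpM2l//; lra.
(* Convexity is used in one argument at a time: first around the new opinion of [z2], then around an
   old opinion. *)
move=> z1 z2; apply: (hull_le) => u; rewrite (is_norm_distC nrmP).
apply: hull_le => v.
exact: sr.
Qed.

(** The two new opinions are convex combinations of the same two old ones with exchanged weights, so
    the two convexity bounds add up to the old sum. *)
Lemma sum_dist_update x y eta p : x != y ->
  \sum_z nrm (upd x y eta z - p) <= \sum_z nrm (eta z - p).
Proof.
move=> xy; rewrite -subr_le0 (sum_deffuant_update (fun v => nrm (v - p)))//.
rewrite /deffuant_update eqxx eq_sym (negbTE xy).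
set m := mu * _.
have m01 : 0 <= m <= 1 by exact: rate_itv.
have := is_norm_convex nrmP (eta x) (eta y) p m01.
have := is_norm_convex nrmP (eta y) (eta x) p m01; rewrite eqxx; lra.
Qed.

(** In each coordinate, (a + m (b - a))^2 + (b + m (a - b))^2 = a^2 + b^2 - 2 m (1 - m) (a - b)^2,
    where m is [mu] or 0. *)
Lemma energy_update x y eta : x != y ->
  energy (upd x y eta) = energy eta
    - 2 * mu * (1 - mu) * (nrm (eta x - eta y) <= tau)%R%:R
      * \sum_i (eta x - eta y) 0 i ^+ 2.
Proof.
move=> xy; apply/eqP; rewrite -subr_eq0 opprB addrCA addrC /energy.
rewrite (sum_deffuant_update (fun v => \sum_i v 0 i ^+ 2))//.
rewrite /deffuant_update eqxx (eq_sym y x) (negbTE xy) eqxx mulr_sumr.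
rewrite -!big_split/= -sumrB -big_split/=; apply/eqP; apply: big1 => i _.
by rewrite !mxE; case: (nrm _ <= _) => /=; ring.
Qed.

Lemma energy_update_le x y eta : x != y -> energy (upd x y eta) <= energy eta.
Proof.
move: mu0 mu_half => ? ? xy; rewrite energy_update// lerBlDr lerDl.
rewrite !mulr_ge0//; first by lra.
  by lra.
by apply: sumr_ge0 => i _; rewrite sqr_ge0.
Qed.

End update.

(** * Trajectories between rings *)

Section real_induction.
Context (R : realType).

Lemma near_right_ex (t : R) (P : R -> Prop) :
  (\forall s \near t^'+, P s) ->
  exists2 v, t < v & forall s, t < s -> s < v -> P s.
Proof.
move=> /nbhs_ballP[e /= e0 he]; exists (t + e); first by rewrite ltrDl.
move=> s ts sv; apply: he => //=.
by rewrite /ball/= distrC gtr0_norm ?subr_gt0// ltrBlDl.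
Qed.

Lemma near_left_ex (t : R) (P : R -> Prop) :
  (\forall s \near t^'-, P s) ->
  exists2 v, v < t & forall s, v < s -> s < t -> P s.
Proof.
move=> /nbhs_ballP[e /= e0 he]; exists (t - e); first by rewrite ltrBlDr ltrDl.
move=> s ts sv; apply: he => //=.
by rewrite /ball/= gtr0_norm ?subr_gt0// ltrBlDr addrC -ltrBlDr.
Qed.

(** This replaces an induction over the successive rings, which then need not be enumerated. The
    supremum of the times up to which [P] holds satisfies [P] by the left step, and the right step
    would push it further if it were below [t]. *)
Lemma real_induction (s t : R) (P : R -> Prop) :
  s <= t -> P s ->
  (forall u, s <= u -> u < t -> P u -> \forall v \near u^'+, P v) ->
  (forall u, s < u -> u <= t -> (forall v, s <= v -> v < u -> P v) -> P u) ->
  P t.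
Proof.
move=> st Ps Pright Pleft.
pose A := [set u | s <= u <= t /\ forall v, s <= v -> v <= u -> P v].
have As : A s.
  split; first by rewrite lexx.
  by move=> v sv vs; have -> : v = s by apply/le_anti; rewrite vs sv.
have At u : A u -> u <= t by case=> /andP[].
have supA : has_sup A by split; [exists s|exists t => u /At].
have s_sup : s <= sup A := ub_le_sup (proj2 supA) As.
have sup_t : sup A <= t by apply: ge_sup; [exists s|move=> u /At].
have belowP v : s <= v -> v < sup A -> P v.
  move=> sv /(sup_gt _)[]; first by exists s.
  by move=> u [_ Pu] vu; apply: Pu => //; exact: ltW.
have Psup : P (sup A).
  have [<-//|ssup] := eqVneq s (sup A).
  by apply: Pleft => //; rewrite lt_neqAle ssup.
have [<-//|sup_neq_t] := eqVneq (sup A) t.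
have sup_lt_t : sup A < t by rewrite lt_neqAle sup_neq_t.
have [v supv Pv] := near_right_ex (Pright _ s_sup sup_lt_t Psup).
pose w := Num.min t ((sup A + v) / 2).
have supw : sup A < w by rewrite lt_min sup_lt_t/= midf_lt.
have wv : w < v.
  by apply: le_lt_trans (_ : (sup A + v) / 2 < v); rewrite ?midf_lt// ge_min lexx orbT.
suff Aw : A w by have := ub_le_sup (proj2 supA) Aw; rewrite leNgt supw.
split; first by rewrite ge_min lexx/= andbT (le_trans s_sup)// ltW.
move=> r sr rw; have [rsup|supr|->//] := ltgtP r (sup A).
  exact: belowP.
by apply: Pv => //; exact: le_lt_trans wv.
Qed.

End real_induction.

Section counting_path.
Context (R : realType) (n : R -> nat).
Hypothesis n_mono : forall s t, 0 <= s -> s <= t -> (n s <= n t)%N.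
Hypothesis n_right : forall t, 0 <= t -> \forall s \near t^'+, n s = n t.

Lemma no_jump_time s t u : 0 <= s -> n s = n t -> s < u -> u <= t ->
  ~ jump_time n u.
Proof.
move=> s0 nst su ut [_ /(_ s s0 su)]; apply/negP; rewrite -leqNgt nst.
by apply: n_mono => //; rewrite (le_trans s0)// ltW.
Qed.

(** Without such a [u], real induction would propagate the value [n s] up to time [t]. *)
Lemma first_jump_time s t : 0 <= s -> s <= t -> (n s < n t)%N ->
  exists u, [/\ s < u, u <= t, jump_time n u &
    forall r, s <= r -> r < u -> n r = n s].
Proof.
move=> s0 st nst; apply: contrapT => nex.
suff : n t = n s by move=> nts; rewrite nts ltnn in nst.
apply: (real_induction (s := s) (P := fun u => n u = n s)) => //.
- move=> u su ut nus; have := n_right (le_trans s0 su).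
  by apply: filterS => v ->.
- move=> u su ut before; apply: contrapT => /eqP nus; apply: nex; exists u.
  split=> //; split; first exact: le_lt_trans su.
  move=> r r0 ru; have [rs|sr] := ltP r s.
    apply: leq_ltn_trans (n_mono r0 (ltW rs)) _.
    by rewrite ltn_neqAle eq_sym nus n_mono// ltW.
  by rewrite before// ltn_neqAle eq_sym nus n_mono// ltW.
Qed.

End counting_path.

Section trajectory.
Context (R : realType) (d : nat) (V : finType).
Variables (E : {set {set V}}) (nrm : 'rV[R]_d -> R) (tau mu : R).
Variables (n : {set V} -> R -> nat) (xi : R -> V -> 'rV[R]_d).
Hypothesis E_simple : simple_graph E.
Hypothesis n_mono : forall a, a \in E ->
  forall s t, 0 <= s -> s <= t -> (n a s <= n a t)%N.
Hypothesis n_right : forall a, a \in E ->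
  forall t, 0 <= t -> \forall s \near t^'+, n a s = n a t.
Hypothesis xi_right : forall t, 0 <= t -> \forall s \near t^'+, xi s = xi t.
Hypothesis xi_path : deffuant_path E nrm tau mu n xi.

(** The dynamics only gives the configuration just before [t]; as it is attained at an actual time
    of ]s, t[, it inherits what is known on that interval. *)
Lemma left_limit_ex (eta : V -> 'rV[R]_d) s t : s < t ->
  (\forall r \near t^'-, xi r = eta) -> exists r, [/\ s < r, r < t & xi r = eta].
Proof.
move=> st /near_left_ex[v vt hv]; have mt : Num.max s v < t by rewrite gt_max st.
exists ((Num.max s v + t) / 2).
have lt_mid : Num.max s v < (Num.max s v + t) / 2 by rewrite midf_lt.
split; first by apply: le_lt_trans lt_mid; rewrite le_max lexx.
  by rewrite midf_lt.
by apply: hv; rewrite ?midf_lt//; apply: le_lt_trans lt_mid; rewrite le_max lexx orbT.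
Qed.

(* This includes times of simultaneous rings, where the dynamics still says that
   the new configuration is the update along any one of the ringing edges. *)
Lemma trajectory_invariant (I : (V -> 'rV[R]_d) -> Prop) s t :
  (forall x y eta, x != y -> [set x; y]%SET \in E -> I eta ->
     I (deffuant_update nrm tau mu x y eta)) ->
  0 <= s -> s <= t -> I (xi s) -> I (xi t).
Proof.
move=> Iupd s0 st Is.
apply: (real_induction (s := s) (P := fun u => I (xi u))) => //.
- move=> u su ut Iu; have := xi_right (le_trans s0 su).
  by apply: filterS => v ->.
- move=> u su ut before.
  have [eta [near_eta jump nojump]] := xi_path (le_lt_trans s0 su).
  have Ieta : I eta.
    have [r [sr ru <-]] := left_limit_ex su near_eta.
    by apply: before => //; exact: ltW.
  have [[a [aE ja]]|none] := pselect (exists a, a \in E /\ jump_time (n a) u).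
    have /eqP/cards2P[x [y [xy axy]]] := E_simple aE.
    by subst a; rewrite (jump x y aE ja); apply: Iupd.
  by rewrite nojump// => a aE ja; apply: none; exists a.
Qed.

Lemma trajectory_const s t : 0 <= s -> s <= t ->
  (forall a, a \in E -> n a s = n a t) -> xi t = xi s.
Proof.
move=> s0 st nst.
apply: (real_induction (s := s) (P := fun u => xi u = xi s)) => //.
- move=> u su ut xiu; have := xi_right (le_trans s0 su).
  by apply: filterS => v ->.
- move=> u su ut before.
  have [eta [near_eta _ nojump]] := xi_path (le_lt_trans s0 su).
  have [r [sr ru reta]] := left_limit_ex su near_eta.
  rewrite nojump; first by rewrite -reta before// ltW.
  by move=> a aE; apply: (no_jump_time (n_mono aE) s0 (nst _ aE)).
Qed.

(** Before the first ring of the edge no clock has moved since [s], so the configuration that gets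
    updated is still [xi s]. *)
Lemma trajectory_first_update s t x y : 0 <= s -> s <= t ->
  [set x; y]%SET \in E -> (n [set x; y]%SET s < n [set x; y]%SET t)%N ->
  (forall b, b \in E -> b != [set x; y]%SET -> n b s = n b t) ->
  exists u, [/\ s < u, u <= t,
    (forall r, s <= r -> r < u -> n [set x; y]%SET r = n [set x; y]%SET s),
    jump_time (n [set x; y]%SET) u &
    xi u = deffuant_update nrm tau mu x y (xi s)].
Proof.
move=> s0 st aE nst others.
have [u [su ut ju before]] := first_jump_time (n_mono aE) (n_right aE) s0 st nst.
exists u; split=> //.
have [eta [near_eta jump _]] := xi_path (le_lt_trans s0 su).
have [r [sr ru reta]] := left_limit_ex su near_eta.
rewrite (jump x y)// -reta; congr deffuant_update.
apply: trajectory_const => //; first exact: ltW.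
move=> b bE; have [->|ba] := eqVneq b [set x; y]%SET.
  by rewrite before// ltW.
apply/eqP; rewrite eqn_leq n_mono ?(ltW sr)//= (others _ bE ba) n_mono//.
  by rewrite (le_trans s0)// ltW.
by rewrite (le_trans (ltW ru)).
Qed.

(** After its first ring the edge has reached its final count, so nothing moves any more until
    [t]. *)
Lemma trajectory_single_update s t x y : 0 <= s -> s <= t ->
  [set x; y]%SET \in E -> n [set x; y]%SET t = (n [set x; y]%SET s).+1 ->
  (forall b, b \in E -> b != [set x; y]%SET -> n b s = n b t) ->
  xi t = deffuant_update nrm tau mu x y (xi s).
Proof.
move=> s0 st aE nst others.
have nlt : (n [set x; y]%SET s < n [set x; y]%SET t)%N by rewrite nst.
have [u [su ut _ [_ ju] <-]] := trajectory_first_update s0 st aE nlt others.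
have u0 : 0 <= u by rewrite (le_trans s0)// ltW.
apply: trajectory_const => // b bE; apply/eqP; rewrite eqn_leq n_mono//=.
have [->|ba] := eqVneq b [set x; y]%SET; first by rewrite nst ju.
by rewrite -(others _ bE ba) n_mono// ltW.
Qed.

End trajectory.

(** * Measurability *)

Section measurability.
Context (R : realType) (d : nat) (nrm : 'rV[R]_d -> R).
Hypothesis nrmP : is_norm nrm.
Context (disp : measure_display) (T : measurableType disp).
Implicit Types f g : T -> 'rV[R]_d.

Lemma measurable_fun_of_lt (f : T -> R) :
  (forall r, measurable [set w | f w < r]) -> measurable_fun setT f.
Proof.
move=> mf; apply: (measurability _ (RGenInftyO.measurableE R)) => //= _ [_ [r ->] <-].
by rewrite setTI set_itvE; exact: mf.
Qed.

Lemma measurable_lt_cst (f : T -> R) r :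
  measurable_fun setT f -> measurable [set w | f w < r].
Proof.
move=> mf; have := mf measurableT _ (measurable_itv `]-oo, r[).
by rewrite setTI set_itvE.
Qed.

Lemma measurable_le_cst (f : T -> R) r :
  measurable_fun setT f -> measurable [set w | f w <= r].
Proof.
move=> mf; have := mf measurableT _ (measurable_itv `]-oo, r]).
by rewrite setTI set_itvE.
Qed.

Lemma measurable_ge_cst (f : T -> R) r :
  measurable_fun setT f -> measurable [set w | r <= f w].
Proof.
move=> mf; have := mf measurableT _ (measurable_itv `[r, +oo[).
by rewrite setTI set_itvE.
Qed.

(** Working by coordinates leaves only real-valued functions to combine. *)
Definition coord_measurable f :=
  forall i, measurable_fun setT (fun w => f w 0 i : R).

Lemma borel_coord_measurable f :
  measurable_fun setT (f : T -> borel_rV R d) -> coord_measurable f.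
Proof.
move=> mf i.
apply: (@measurableT_comp _ _ _ _ (borel_rV R d) R
  (fun v => (v : 'rV[R]_d) 0 i) setT f) => //.
apply: (measurability _ (RGenOpens.measurableE R)) => //= _ [_ [x [y ->]] <-].
rewrite setTI; apply: sub_sigma_algebra.
apply: (@open_comp _ _ (fun v : 'rV[R]_d => v 0 i)); last exact: interval_open.
by move=> v _; exact: coord_continuous.
Qed.

Lemma coord_measurableB f g : coord_measurable f -> coord_measurable g ->
  coord_measurable (fun w => f w - g w).
Proof.
move=> mf mg i; apply: (eq_measurable_fun (fun w => f w 0 i - g w 0 i)).
  by move=> w _; rewrite !mxE.
exact: measurable_funB.
Qed.

Lemma coord_measurable_cst v : coord_measurable (fun=> v).
Proof. by move=> i; exact: measurable_cst. Qed.

(** The norm of [v] is the infimum over rational vectors [q] of the norm of [q] plus the l1 bound on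
    the norm of [v - q]. This turns a strict inequality on the norm into a countable union of
    conditions on the coordinates. *)
Lemma is_norm_lt_ratP (C : R) v r : 0 < C ->
  (forall u, nrm u <= C * \sum_i `|u 0 i|) ->
  nrm v < r <-> exists q : 'rV[rat]_d,
    nrm (map_mx ratr q) + C * (\sum_i `|v 0 i - ratr (q 0 i)|) < r.
Proof.
move=> C0 nrmC; split=> [vr|[q]]; last first.
  apply: le_lt_trans; rewrite -[v in nrm v](subrK (map_mx ratr q)) addrC.
  apply: le_trans (is_norm_triangle nrmP _ _) _; rewrite lerD2l.
  apply: le_trans (nrmC _) _; rewrite ler_pM2l//.
  by apply: ler_sum => i _; rewrite !mxE.
(* The l1 error is paid twice, once in the formula and once to bound the norm of [q], so it has to
   cost less than half of the slack [r - nrm v]. *)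
pose e := (r - nrm v) / (2 * C * d.+1%:R).
have e0 : 0 < e by rewrite divr_gt0 ?subr_gt0// !mulr_gt0.
have /choice[q hq] (i : 'I_d) : exists q : rat, `|v 0 i - ratr q| <= e.
  have [q /=] := rat_in_itvoo (ltr_pwDr e0 (lexx (v 0 i))).
  rewrite in_itv/= => /andP[vq qv]; exists q.
  by rewrite distrC gtr0_norm ?subr_gt0// lerBlDl ltW.
exists (\row_i q i).
have sum_e : C * (\sum_i `|v 0 i - ratr ((\row_i q i) 0 i)|) < (r - nrm v) / 2.
  apply: (@le_lt_trans _ _ (C * (d%:R * e))).
    rewrite ler_pM2l//; apply: (@le_trans _ _ (\sum_(i < d) e)).
      by apply: ler_sum => i _; rewrite mxE.
    by rewrite sumr_const card_ord mulr_natl.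
  have -> : C * (d%:R * e) = (r - nrm v) / 2 * (d%:R / d.+1%:R).
    by rewrite /e -natr1; field; rewrite nat1r pnatr_eq0 lt0r_neq0.
  rewrite gtr_pMr ?divr_gt0 ?subr_gt0//.
  by rewrite ltr_pdivrMr// mul1r ltr_nat.
suff : nrm (map_mx ratr (\row_i q i)) <= nrm v +
    C * (\sum_i `|v 0 i - ratr ((\row_i q i) 0 i)|) by move: sum_e; lra.
rewrite -[X in nrm X](subrK v) addrC.
apply: le_trans (is_norm_triangle nrmP _ _) _; rewrite lerD2l.
apply: le_trans (nrmC _) _; rewrite ler_pM2l//.
by apply: ler_sum => i _; rewrite !mxE distrC.
Qed.

Lemma measurable_is_norm f :
  coord_measurable f -> measurable_fun setT (fun w => nrm (f w)).
Proof.
move=> mf; have [C C0 nrmC] := is_norm_le_l1 nrmP.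
apply: measurable_fun_of_lt => r.
rewrite (_ : [set w | _] = \bigcup_(q : 'rV[rat]_d) [set w |
    nrm (map_mx ratr q) + C * (\sum_i `|f w 0 i - ratr (q 0 i)|) < r]); last first.
  apply/seteqP; split=> w /=.
    by move=> /(is_norm_lt_ratP _ _ C0 nrmC)[q hq]; exists q.
  by move=> [q _ hq]; apply/(is_norm_lt_ratP _ _ C0 nrmC); exists q.
apply: countable_bigcupT_measurable => // q; apply: measurable_lt_cst.
apply: measurable_funD => //; apply: measurable_funM => //.
apply: measurable_sum => i; apply: measurableT_comp => //.
exact: measurable_funB.
Qed.

End measurability.

(** * Independence of past and future *)

Section generated.
Context (R : realType) (disp : measure_display) (T : measurableType disp).
Variable P : probability T R.

Lemma measurable_fun_generated (I : Type) (D : set I) (disp' : measure_display)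
    (S : measurableType disp') (f : I -> T -> S) (i : I) : D i ->
  measurable_fun setT (f i : g_sigma_algebraType
    (\bigcup_(j in D) g_sigma_algebra_preimage (f j)) -> S).
Proof.
move=> Di _ B mB; apply: sub_sigma_algebra.
by exists i => //; exists B => //.
Qed.

Lemma sub_sigma_generated (I J : Type) (D : set I) (D' : set J)
    (disp' : measure_display) (S : measurableType disp')
    (f : I -> T -> S) (g : J -> T -> S) :
  (forall j, D' j -> exists2 i, D i & f i = g j) ->
  sigma_generated D' g `<=` sigma_generated D f.
Proof.
move=> fg; apply: sub_smallest2r; first exact: smallest_sigma_algebra.
move=> A [j D'j gA]; have [i Di fi] := fg _ D'j.
by exists i => //; rewrite fi.
Qed.

Lemma sigma_generated_measurable (I : Type) (D : set I) (disp' : measure_display)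
    (S : measurableType disp') (f : I -> T -> S) :
  (forall i, D i -> measurable_fun setT (f i)) ->
  sigma_generated D f `<=` measurable.
Proof.
move=> mf; apply: smallest_sub; first exact: sigma_algebra_measurable.
by move=> A [i Di [B mB <-]]; exact: mf.
Qed.

Lemma sigma_generated_fin_bigcap (I : Type) (D : set I) (disp' : measure_display)
    (S : measurableType disp') (f : I -> T -> S)
    (J : choiceType) (Q : set J) (F : J -> set T) : finite_set Q ->
  (forall j, Q j -> sigma_generated D f (F j)) ->
  sigma_generated D f (\bigcap_(j in Q) F j).
Proof.
pose G := \bigcup_(i in D) g_sigma_algebra_preimage (f i).
exact: (@fin_bigcap_measurable _ (g_sigma_algebraType G) J Q F).
Qed.

Lemma mutually_independent2 (I : choiceType) (D : set I)
    (F : I -> set (set T)) a b A B :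
  mutually_independent P D F -> D a -> D b -> a != b -> F a A -> F b B ->
  P (A `&` B) = (P A * P B)%E.
Proof.
move=> indF Da Db ab FA FB.
pose C i := if i == a then A else B.
have := indF [fset a; b]%fset C.
rewrite big_fsetU1 ?inE//= big_seq_fset1 /C eqxx eq_sym (negbTE ab).
move=> <-; first last.
- by move=> i; rewrite !inE => /orP[]/eqP->; rewrite ?eqxx// eq_sym (negbTE ab).
- by move=> i /=; rewrite !inE => /orP[]/eqP->.
congr (P _); apply/seteqP; split=> w.
  by move=> [Aw Bw] i /=; rewrite !inE => /orP[]/eqP->; rewrite ?eqxx// eq_sym (negbTE ab).
move=> h; split; first by have := h a; rewrite eqxx; apply; rewrite /= !inE eqxx.
by have := h b; rewrite eq_sym (negbTE ab); apply; rewrite /= !inE eqxx orbT.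
Qed.

End generated.

Section grid.
Context (R : realType) (d : nat) (V : finType).
Variables (E : {set {set V}}) (Delta : set 'rV[R]_d) (nrm : 'rV[R]_d -> R).
Variables (tau mu : R).
Context (disp : measure_display) (T : measurableType disp).
Variables (P : probability T R) (N : {set V} -> R -> T -> nat).
Variable xi : R -> T -> V -> 'rV[R]_d.
Hypothesis model : deffuant_model E Delta nrm tau mu P N xi.
Variable t : nat -> R.
Hypothesis t0 : 0 <= t 0%N.
Hypothesis t_mono : {homo t : i j / (i <= j)%N >-> i <= j}.
Implicit Types (C : {set V} -> nat -> set nat) (a b : {set V}).

Definition increment a i w := (N a (t i.+1) w - N a (t i) w)%N.

Definition clock_event K C : set T :=
  \bigcap_(a in [set` E]) \bigcap_(i in `I_K) (increment a i @^-1` C a i).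

Definition initial_sigma := sigma_generated setT
  (fun x w => xi 0 w x : borel_rV R d).

Let t_ge0 i : 0 <= t i.
Proof. by apply: le_trans t0 (t_mono _). Qed.

Lemma increment_generated a i (C : set nat) :
  sigma_generated [set s | 0 <= s] (N a) (increment a i @^-1` C).
Proof.
have mN j := measurable_fun_generated (D := [set s | 0 <= s]) (f := N a) (t_ge0 j).
by have := measurable_fun_subn (mN i.+1) (mN i) measurableT (Y := C) I; rewrite setTI.
Qed.

Lemma edge_event_generated a K C :
  sigma_generated [set s | 0 <= s] (N a)
    (\bigcap_(i in `I_K) (increment a i @^-1` C a i)).
Proof.
apply: sigma_generated_fin_bigcap => [|i _]; first exact: finite_II.
exact: increment_generated.
Qed.

Lemma initial_sigma_measurable : initial_sigma `<=` measurable.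
Proof.
by apply: sigma_generated_measurable => x _; apply: (deffuant_measurable model).
Qed.

Lemma measurable_increment a i (C : set nat) :
  a \in E -> measurable (increment a i @^-1` C).
Proof.
move=> aE; have [mN _ _ _ _ _] := deffuant_clock model aE.
have := sigma_generated_measurable (D := [set s : R | 0 <= s]) mN.
by apply; exact: increment_generated.
Qed.

Lemma measurable_clock_event K C : measurable (clock_event K C).
Proof.
apply: fin_bigcap_measurable => // a aE; apply: bigcap_measurableType => i _.
exact: measurable_increment.
Qed.

Lemma edge_event_prob a K C : a \in E ->
  P (\bigcap_(i in `I_K) (increment a i @^-1` C a i)) =
  (\prod_(i < K) P (increment a i @^-1` C a i))%E.
Proof.
move=> aE; have [_ _ _ _ _ ind] := deffuant_clock model aE.
have := ind t t0 t_mono [fset i in iota 0 K]%fset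
  (fun i => increment a i @^-1` C a i).
rewrite (_ : [set` [fset i in iota 0 K]%fset] = `I_K); last first.
  by apply/seteqP; split=> i /=; rewrite !inE/= mem_iota add0n.
move=> ->//; last by move=> i _; exists (C a i) => //; rewrite setTI.
rewrite -(big_mkord xpredT (fun i => P (increment a i @^-1` C a i))).
apply: perm_big; rewrite /index_iota subn0; apply: uniq_perm.
- exact: fset_uniq.
- exact: iota_uniq.
- by move=> i; rewrite !inE.
Qed.

(** Three independences combine: of the initial opinions and the clocks, of the clocks of distinct
    edges, and of the increments of one clock. *)
Lemma clock_event_prob (B : set T) K C : initial_sigma B ->
  P (B `&` clock_event K C) =
  (P B * \prod_(a in E) \prod_(i < K) P (increment a i @^-1` C a i))%E.
Proof.
move=> mB; pose A a := \bigcap_(i in `I_K) (increment a i @^-1` C a i).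
rewrite (deffuant_initial_independent model mB); last first.
  apply: sigma_generated_fin_bigcap => // a aE.
  move: (@edge_event_generated a K C); apply: sub_sigma_generated => s s0.
  by exists (a, s).
congr (_ * _)%E.
have := deffuant_clocks_independent model (J := [fset a in E]%fset) (A := A).
rewrite (_ : [set` [fset a in E]%fset] = [set` E]); last first.
  by apply/seteqP; split=> a /=; rewrite !inE.
move=> ->//; last by move=> a _; exact: edge_event_generated.
rewrite -big_enum/=.
under [RHS]eq_big_seq => a.
  rewrite mem_enum => aE; rewrite -edge_event_prob//; over.
apply: perm_big; apply: uniq_perm.
- exact: fset_uniq.
- exact: enum_uniq.
- by move=> a; rewrite !inE mem_enum.
Qed.

Definition ringing i w : {set {set V}} := [set a in E | (0 < increment a i w)%N]%SET.

(** Recording which edges ring, and not how often, leaves finitely many words, over which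
    probabilities can be summed. *)
Definition word K w : K.-tuple {set {set V}} := [tuple ringing i w | i < K].

Lemma nth_word K w i : (i < K)%N -> nth finset.set0 (word K w) i = ringing i w.
Proof. by move=> iK; rewrite (nth_mktuple _ finset.set0 (Ordinal iK)). Qed.

Let word_clocks K (u : K.-tuple {set {set V}}) (H : {set V} -> set nat) a i :=
  if (i < K)%N then [set k | (0 < k)%N = (a \in nth finset.set0 u i)] else H a.

Let word_eq_clock_event K (u : K.-tuple {set {set V}}) (H : {set V} -> set nat) :
  (forall i, (i < K)%N -> nth finset.set0 u i \subset E) ->
  [set w | word K w = u] `&` \bigcap_(a in [set` E]) (increment a K @^-1` H a) =
  clock_event K.+1 (word_clocks u H).
Proof.
move=> uE; apply/seteqP; split=> w.
  move=> [/= wu GH] a aE i /=; rewrite ltnS leq_eqVlt /word_clocks => /orP[/eqP->|iK].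
    by rewrite ltnn; exact: GH.
  by rewrite iK/= -wu nth_word// inE (_ : a \in E).
move=> clk; split=> [/=|a aE /=]; last first.
  by have := clk a aE K (ltnSn K); rewrite /word_clocks/= ltnn.
apply: eq_from_tnth => i; rewrite !(tnth_nth finset.set0) nth_word//.
apply/finset.setP => a; rewrite inE.
have [aE|aE] /= := boolP (a \in E).
  have iK : (i < K.+1)%N by rewrite ltnS ltnW.
  by have := clk a aE i iK; rewrite /word_clocks/= ltn_ord.
apply/esym/negbTE; apply: contra aE.
by move/(fintype.subsetP (uE i (ltn_ord i))).
Qed.

Let word_outside K w (u : K.-tuple {set {set V}}) i :
  (i < K)%N -> ~~ (nth finset.set0 u i \subset E) -> word K w <> u.
Proof.
move=> iK; apply: contraNnot => <-; rewrite nth_word//.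
by apply/fintype.subsetP => a; rewrite inE => /andP[].
Qed.

(** For each word the probability factors as [c u * q H], where [c u] does not depend on [H].
    Summing over the words, and once more with [H] always true, where [q] is 1, identifies the sum
    of the [c u] as the probability of the past event. *)
Lemma past_future_independent K (F : K.-tuple {set {set V}} -> set T)
    (H : {set V} -> set nat) : (forall u, initial_sigma (F u)) ->
  P ([set w | F (word K w) w] `&`
      \bigcap_(a in [set` E]) (increment a K @^-1` H a)) =
  (P [set w | F (word K w) w] * \prod_(a in E) P (increment a K @^-1` H a))%E.
Proof.
move=> mF.
pose q H' : \bar R := (\prod_(a in E) P (increment a K @^-1` H' a))%E.
pose A H' u := F u `&` ([set w | word K w = u] `&`
  \bigcap_(a in [set` E]) (increment a K @^-1` H' a)).
have [c PA] : exists c, forall u H', (measurable (A H' u) /\ P (A H' u) = c u * q H')%E.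
  suff /choice[c hc] u : exists c, forall H',
      (measurable (A H' u) /\ P (A H' u) = c * q H')%E by exists c.
  have [uE|/existsNP[i /not_implyP[iK uE]]] :=
    pselect (forall i, (i < K)%N -> nth finset.set0 u i \subset E).
    exists (P (F u) * \prod_(a in E) \prod_(i < K)
      P (increment a i @^-1` [set k | (0 < k)%N = (a \in nth finset.set0 u i)]))%E => H'.
    rewrite /A word_eq_clock_event//; split.
      apply: measurableI; last exact: measurable_clock_event.
      exact: initial_sigma_measurable.
    rewrite clock_event_prob// -muleA -big_split/=; congr (_ * _)%E.
    apply: eq_bigr => a aE; rewrite big_ord_recr/= /word_clocks ltnn.
    by congr (_ * _)%E; apply: eq_bigr => i _; rewrite ltn_ord.
  (* A word with a letter that is not a set of edges never occurs. *)
  exists 0%E => H'; rewrite mul0e.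
  have -> : A H' u = set0; last by rewrite measure0.
  apply/seteqP; split=> // w [_ [wu _]].
  by apply: (word_outside iK _ wu); apply/negP.
have split_words H' : [set w | F (word K w) w] `&`
    \bigcap_(a in [set` E]) (increment a K @^-1` H' a) =
    \bigcup_(u in [set: K.-tuple {set {set V}}]) A H' u.
  apply/seteqP; split=> w.
    by move=> [Fw GH]; exists (word K w).
  by move=> [u _ [Fu [/= wu GH]]]; split=> //=; rewrite wu.
have PS H' : (P ([set w | F (word K w) w] `&`
    \bigcap_(a in [set` E]) (increment a K @^-1` H' a)) =
    \sum_(u \in [set: K.-tuple {set {set V}}]) c u * q H')%E.
  rewrite split_words measure_fin_bigcup; first last.
  - by move=> u _; have [] := PA u H'.
  - by move=> u v _ _ [w [[_ [/= <- _]] [_ [/= <- _]]]].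
  - exact: finite_finset.
  - by apply: eq_fsbigr => u _; have [_] := PA u H'.
have qT : q (fun=> setT) = 1%E.
  by rewrite /q big1// => a _; rewrite preimage_setT probability_setT.
have PF : P [set w | F (word K w) w] =
    (\sum_(u \in [set: K.-tuple {set {set V}}]) c u)%E.
  rewrite -[LHS](_ : P ([set w | F (word K w) w] `&`
    \bigcap_(a in [set` E]) (increment a K @^-1` setT)) = _); last first.
    by congr (P _); apply/seteqP; split=> [w []|w Fw]//.
  by rewrite (PS (fun=> setT)) qT; apply: eq_fsbigr => u _; rewrite mule1.
rewrite PS PF -/(q H) ge0_mule_fsuml// => u.
have [_] := PA u (fun=> setT); rewrite qT mule1 => <-; exact: measure_ge0.
Qed.

Lemma measurable_word_event K (F : K.-tuple {set {set V}} -> set T) :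
  (forall u, initial_sigma (F u)) -> measurable [set w | F (word K w) w].
Proof.
move=> mF; rewrite (_ : [set w | _] = \bigcup_(u in [set: K.-tuple {set {set V}}])
    (F u `&` [set w | word K w = u])); last first.
  apply/seteqP; split=> w; first by move=> Fw; exists (word K w).
  by move=> [u _ [Fu /= wu]]; rewrite wu.
apply: fin_bigcup_measurable => [|u _]; first exact: finite_finset.
 apply: measurableI.
  exact: initial_sigma_measurable.
have [uE|/existsNP[i /not_implyP[iK uE]]] :=
    pselect (forall i, (i < K)%N -> nth finset.set0 u i \subset E).
  have := word_eq_clock_event (fun=> setT) uE.
  rewrite (_ : \bigcap_(a in _) _ = setT) ?setIT; last first.
    by apply/seteqP; split.
  by move=> ->; exact: measurable_clock_event.
rewrite (_ : [set w | _] = set0)//; apply/seteqP; split=> // w /= wu.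
by apply: (word_outside iK _ wu); apply/negP.
Qed.

End grid.

(** * Evolution along a grid *)

Section evolution.
Context (R : realType) (d : nat) (V : finType).
Variables (nrm : 'rV[R]_d -> R) (tau mu : R).
Hypothesis nrmP : is_norm nrm.
Implicit Types (eta : V -> 'rV[R]_d) (S : {set {set V}}).

(* When at most one edge rings, S is empty or the singleton of that edge, and
   then the two possible picks (x, y) and (y, x) give the same update. *)
Definition ring_step S eta : V -> 'rV[R]_d :=
  if [pick p : V * V | [set p.1; p.2]%SET \in S] is Some p
  then deffuant_update nrm tau mu p.1 p.2 eta else eta.

Definition evolve (u : seq {set {set V}}) eta :=
  foldl (fun eta S => ring_step S eta) eta u.

Section measurable_evolution.
Context (disp : measure_display) (T : measurableType disp).

Lemma coord_measurable_update (f : T -> V -> 'rV[R]_d) x y :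
  (forall z, coord_measurable (f ^~ z)) ->
  forall z, coord_measurable (fun w => deffuant_update nrm tau mu x y (f w) z).
Proof.
move=> mf z; rewrite /deffuant_update.
have rate_measurable : measurable_fun setT
    (fun w => mu * (nrm (f w x - f w y) <= tau)%R%:R).
  apply: measurable_funM => //.
  rewrite (_ : (fun w => _) = \1_[set w | nrm (f w x - f w y) <= tau]); last first.
    by apply/funext => w; rewrite indicE; congr (_%:R); rewrite mem_setE.
  apply: measurable_indic; apply: measurable_le_cst; apply: measurable_is_norm => //.
  exact: coord_measurableB.
have moved a b : coord_measurable (fun w =>
    f w a + (mu * (nrm (f w x - f w y) <= tau)%R%:R) *: (f w b - f w a)).
  move=> i; apply: (eq_measurable_fun (fun w => f w a 0 i +
      (mu * (nrm (f w x - f w y) <= tau)%R%:R) * (f w b 0 i - f w a 0 i))).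
    by move=> w _; rewrite !mxE.
  apply: measurable_funD; first exact: mf.
  by apply: measurable_funM => //; apply: measurable_funB; exact: mf.
by case: eqP => _ //; case: eqP.
Qed.

Lemma coord_measurable_evolve (u : seq {set {set V}}) (f : T -> V -> 'rV[R]_d) :
  (forall z, coord_measurable (f ^~ z)) ->
  forall z, coord_measurable (fun w => evolve u (f w) z).
Proof.
elim: u f => [//|S u IHu] f mf z; rewrite /evolve/=.
apply: (IHu (fun w => ring_step S (f w))) => {}z; rewrite /ring_step.
by case: pickP => // p _; exact: coord_measurable_update.
Qed.

End measurable_evolution.

Section trajectory_evolution.
Variables (E : {set {set V}}) (Delta : set 'rV[R]_d).
Context (disp : measure_display) (T : measurableType disp).
Variables (P : probability T R) (N : {set V} -> R -> T -> nat).
Variable xi : R -> T -> V -> 'rV[R]_d.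
Hypothesis model : deffuant_model E Delta nrm tau mu P N xi.
Hypothesis E_simple : simple_graph E.
Variable t : nat -> R.
Hypothesis t0 : t 0%N = 0.
Hypothesis t_mono : {homo t : i j / (i <= j)%N >-> i <= j}.

Lemma clock_mono a w : a \in E ->
  forall s r, 0 <= s -> s <= r -> (N a s w <= N a r w)%N.
Proof. by move=> aE s r; case: (deffuant_clock model aE) => _ _ + _ _ _; apply. Qed.

Lemma clock_right a w : a \in E ->
  forall s, 0 <= s -> \forall r \near s^'+, N a r w = N a s w.
Proof. by move=> aE s; case: (deffuant_clock model aE) => _ _ _ + _ _; apply. Qed.

(** Over all pairs this means at most one ring per cell; the case [a == b] excludes repeated rings
    of one edge. *)
Definition collision_free K w := forall i a b, (i < K)%N -> a \in E -> b \in E ->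
  if a == b then (increment N t a i w <= 1)%N
  else (increment N t a i w == 0)%N || (increment N t b i w == 0)%N.

(** Induction on the cells: a cell contains either one ring, which makes one update, or none, and
    then the configuration stays constant. *)
Lemma trajectory_evolve K w :
  deffuant_path E nrm tau mu (fun a s => N a s w) (fun s => xi s w) ->
  collision_free K w ->
  xi (t K) w = evolve (word E N t K w) (xi 0 w).
Proof.
move=> path_w; have -> : word E N t K w = mkseq (ringing E N t ^~ w) K :> seq _.
  by rewrite /= /mkseq -val_enum_ord -map_comp.
elim: K => [|K IHK] free; first by rewrite t0.
rewrite mkseqS /evolve foldl_rcons -/(evolve _ _) -IHK; last first.
  by move=> i a b iK; apply: free; exact: ltnW.
have {}free a b := free K a b (ltnSn K).
have tK0 : 0 <= t K by rewrite -t0 t_mono.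
have tKS : t K <= t K.+1 by exact: t_mono.
have eqN b : b \in E -> increment N t b K w = 0%N -> N b (t K) w = N b (t K.+1) w.
  move=> bE /eqP; rewrite subn_eq0 => h; apply/eqP; rewrite eqn_leq h andbT.
  exact: clock_mono.
have xi_right s := deffuant_right_continuous model w (t := s).
have nm a (aE : a \in E) := clock_mono w aE.
have nr a (aE : a \in E) := clock_right w aE.
rewrite /ring_step; case: pickP => [[x y] /=|none].
  rewrite inE => /andP[xyE inc_gt0].
  apply: (trajectory_single_update (n := fun a s => N a s w)
    (xi := fun s => xi s w) nm nr xi_right path_w) => //.
    have := free _ _ xyE xyE; rewrite eqxx => inc_le1.
    have : increment N t [set x; y]%SET K w = 1%N.
      by apply/eqP; rewrite eqn_leq inc_le1.
    by rewrite /increment => inc1; rewrite -(subnK (nm _ xyE _ _ tK0 tKS)) inc1.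
  move=> b bE bxy; apply: eqN => //; have := free _ _ bE xyE.
  by rewrite (negbTE bxy) => /orP[/eqP//|/eqP inc0]; rewrite inc0 in inc_gt0.
apply: (trajectory_const (n := fun a s => N a s w)
  (xi := fun s => xi s w) nm xi_right path_w) => // b bE.
apply: eqN => //; apply/eqP; rewrite -leqn0 leqNgt; apply/negP => inc_gt0.
have /eqP/cards2P[x [y [_ bxy]]] := E_simple bE.
by have := none (x, y); rewrite /= inE -bxy bE inc_gt0.
Qed.

End trajectory_evolution.

End evolution.

(** * Probability of two rings in one cell *)

Section uniform_grid.
Context (R : realType).
Variables (s : R) (K : nat).
Hypotheses (s_gt0 : 0 < s) (K_gt0 : (0 < K)%N).

(* Beyond s the mesh is 1, so that cell K is the unit of time following s. *)
Definition uniform_grid (i : nat) : R :=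
  if (i <= K)%N then i%:R * (s / K%:R) else s + (i - K)%:R.

Lemma uniform_grid0 : uniform_grid 0 = 0.
Proof. by rewrite /uniform_grid leq0n mul0r. Qed.

Lemma uniform_gridK : uniform_grid K = s.
Proof. by rewrite /uniform_grid leqnn mulrC divfK// pnatr_eq0 -lt0n. Qed.

Lemma uniform_gridSK : uniform_grid K.+1 = s + 1.
Proof. by rewrite /uniform_grid ltnn subSnn. Qed.

Lemma uniform_grid_step i : (i < K)%N ->
  uniform_grid i.+1 - uniform_grid i = s / K%:R.
Proof. by move=> iK; rewrite /uniform_grid iK ltnW// -natr1; ring. Qed.

Lemma uniform_grid_ltS i : uniform_grid i < uniform_grid i.+1.
Proof.
have [iK|Ki] := ltnP i K.
  by rewrite -subr_gt0 uniform_grid_step// divr_gt0// ltr0n.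
have [->|iK] := eqVneq i K; first by rewrite uniform_gridK uniform_gridSK ltrDl.
have Ki' : (K < i)%N by rewrite ltn_neqAle eq_sym iK.
by rewrite /uniform_grid (leqNgt i) Ki' (leqNgt i.+1) ltnS Ki/= ltrD2l ltr_nat subSn.
Qed.

Lemma uniform_grid_mono : {homo uniform_grid : i j / (i <= j)%N >-> i <= j}.
Proof.
by apply: homo_leq => [//|y x z|i]; [exact: le_trans|exact/ltW/uniform_grid_ltS].
Qed.

End uniform_grid.

Section union_bound.
Local Open Scope ereal_scope.

Lemma finite_union_bound (R : realType) (disp : measure_display)
    (T : measurableType disp) (P : probability T R) (J : finType)
    (Q : pred J) (A : J -> set T) (r : R) :
  (0 <= r)%R -> (forall j, Q j -> measurable (A j)) ->
  (forall j, Q j -> P (A j) <= r%:E) ->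
  measurable (\big[setU/set0]_(j | Q j) A j) /\
  P (\big[setU/set0]_(j | Q j) A j) <= (#|J|%:R * r)%:E.
Proof.
move=> r0 mA PA.
have [mU PU] : measurable (\big[setU/set0]_(j | Q j) A j) /\
    P (\big[setU/set0]_(j | Q j) A j) <= \sum_(j | Q j) P (A j).
  elim/big_rec2 : _ => [|j y B Qj [mB PB]]; first by rewrite measure0.
  split; first by apply: measurableU => //; exact: mA.
  apply: (le_trans (measureU2 P (mA _ Qj) mB)); exact: leeD2l.
split=> //; apply: (le_trans PU).
apply: (@le_trans _ _ (\sum_(j in J) r%:E)).
  rewrite big_mkcond/=; apply: lee_sum => j _.
  by case: ifPn => [/PA//|_]; rewrite lee_fin.
by rewrite sumEFin lee_fin sumr_const mulr_natl.
Qed.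

End union_bound.

Section clocks.
Context (R : realType) (d : nat) (V : finType).
Variables (E : {set {set V}}) (Delta : set 'rV[R]_d) (nrm : 'rV[R]_d -> R).
Variables (tau mu : R).
Context (disp : measure_display) (T : measurableType disp).
Variables (P : probability T R) (N : {set V} -> R -> T -> nat).
Variable xi : R -> T -> V -> 'rV[R]_d.
Hypothesis model : deffuant_model E Delta nrm tau mu P N xi.
Variable t : nat -> R.
Hypothesis t0 : 0 <= t 0%N.
Hypothesis t_mono : {homo t : i j / (i <= j)%N >-> i <= j}.
Hypothesis t_lt : forall i, t i < t i.+1.

Let t_ge0 i : 0 <= t i.
Proof. by apply: le_trans t0 (t_mono _). Qed.

Lemma increment_pmf a i k : a \in E ->
  P (increment N t a i @^-1` [set k]) =
  ((t i.+1 - t i) ^+ k * k`!%:R^-1 * expR (- (t i.+1 - t i)))%:E.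
Proof.
move=> aE; have [_ _ _ _ + _] := deffuant_clock model aE.
move=> /(_ _ _ k (t_ge0 i) (t_lt i)); rewrite mul1r /poisson_pmf subr_gt0 t_lt.
by move=> <-; congr (P _).
Qed.

Lemma increment_gt0 a i : a \in E ->
  P (increment N t a i @^-1` [set k | (0 < k)%N]) =
  (1 - expR (- (t i.+1 - t i)))%:E.
Proof.
move=> aE.
have -> : increment N t a i @^-1` [set k | (0 < k)%N] =
    ~` (increment N t a i @^-1` [set 0%N]).
  by apply/seteqP; split=> w /=; rewrite lt0n => /eqP.
rewrite probability_setC; last exact: (measurable_increment model).
by rewrite increment_pmf// expr0 fact0 invr1 !mul1r EFinB.
Qed.

Lemma increment_gt0_le a i : a \in E ->
  (P (increment N t a i @^-1` [set k | (0 < k)%N]) <= (t i.+1 - t i)%:E)%E.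
Proof.
move=> aE; rewrite increment_gt0// lee_fin.
by have := expR_ge1Dx (- (t i.+1 - t i)); lra.
Qed.

(** Since exp(-h) >= 1 - h, the probability 1 - (1 + h) exp(-h) is at most 1 - (1 + h) (1 - h) =
    h^2. *)
Lemma increment_gt1_le a i : a \in E ->
  (P (increment N t a i @^-1` [set k | (1 < k)%N]) <= ((t i.+1 - t i) ^+ 2)%:E)%E.
Proof.
move=> aE; set h := t i.+1 - t i.
have -> : increment N t a i @^-1` [set k | (1 < k)%N] =
    ~` (increment N t a i @^-1` [set 0%N] `|` increment N t a i @^-1` [set 1%N]).
  apply/seteqP; split=> w /=; first by move=> inc_gt1 [] inc; rewrite inc in inc_gt1.
  by move: (increment _ _ _ _ _) => [|[|n]]// []; [left|right].
have mI k := measurable_increment model (t := t) t0 t_mono i [set k] aE.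
rewrite probability_setC; last exact: measurableU.
have -> : P (increment N t a i @^-1` [set 0%N] `|` increment N t a i @^-1` [set 1%N]) =
    (P (increment N t a i @^-1` [set 0%N]) + P (increment N t a i @^-1` [set 1%N]))%E.
  by apply: measureU => //; apply/seteqP; split=> // w [/= ->].
rewrite (increment_pmf i 0%N aE) (increment_pmf i 1%N aE) -/h.
rewrite expr0 expr1 fact0 invr1 !mul1r mulr1 -EFinD.
rewrite lee_fin; have h0 : 0 < h by rewrite subr_gt0.
have /(ler_wpM2l (ltW h0)) := expR_ge1Dx (- h).
have := expR_ge1Dx (- h); rewrite expr2; lra.
Qed.

Definition collision K : set T :=
  \big[setU/set0]_(j : 'I_K * ({set V} * {set V}) | (j.2.1 \in E) && (j.2.2 \in E))
    if j.2.1 == j.2.2 then increment N t j.2.1 j.1 @^-1` [set k | (1 < k)%N]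
    else increment N t j.2.1 j.1 @^-1` [set k | (0 < k)%N] `&`
      increment N t j.2.2 j.1 @^-1` [set k | (0 < k)%N].

Lemma collision_freeP K w : ~ collision K w -> collision_free E N t K w.
Proof.
move=> nocol i a b iK aE bE; apply: contrapT => bad; apply: nocol.
rewrite /collision -bigcup_seq_cond.
exists (Ordinal iK, (a, b)); first by rewrite /= mem_index_enum aE bE.
move: bad => /=; case: eqP => _ /negP; first by rewrite -ltnNge.
by rewrite negb_or -!lt0n => /andP[].
Qed.

(** Each cell and pair of edges contributes at most h^2: two rings of one edge by the Poisson law,
    rings of two edges by independence. With h = s / K the total is O(1 / K). *)
Lemma collision_prob K h : 0 <= h -> (forall i, (i < K)%N -> t i.+1 - t i = h) ->
  measurable (collision K) /\
  (P (collision K) <= (K%:R * #|{: {set V} * {set V}}|%:R * h ^+ 2)%:E)%E.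
Proof.
move=> h0 th.
have -> : K%:R * #|{: {set V} * {set V}}|%:R * h ^+ 2 =
    #|{: 'I_K * ({set V} * {set V})}|%:R * h ^+ 2.
  by rewrite [in RHS]card_prod card_ord natrM.
have mI := measurable_increment model (t := t) t0 t_mono.
apply: finite_union_bound; first exact: exprn_ge0.
  move=> [i [a b]] /andP[/= aE bE]; case: ifP => _; first exact: mI.
  by apply: measurableI; exact: mI.
move=> [i [a b]] /andP[/= aE bE]; case: ifPn => [_|ab].
  by rewrite -(th i (ltn_ord i)); exact: increment_gt1_le.
have := mutually_independent2 (deffuant_clocks_independent model) aE bE ab.
move=> ->; try exact: increment_generated.
rewrite expr2 EFinM -(th i (ltn_ord i)).
by apply: lee_pmul; rewrite ?measure_ge0// increment_gt0_le.
Qed.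

End clocks.

(** * Disagreements and isolated rings *)

Section isolated_ring.
Context (R : realType) (d : nat) (V : finType).
Variables (E : {set {set V}}) (Delta : set 'rV[R]_d) (nrm : 'rV[R]_d -> R).
Variables (tau mu : R).
Context (disp : measure_display) (T : measurableType disp).
Variables (P : probability T R) (N : {set V} -> R -> T -> nat).
Variable xi : R -> T -> V -> 'rV[R]_d.
Hypothesis nrmP : is_norm nrm.
Hypothesis E_simple : simple_graph E.
Hypothesis model : deffuant_model E Delta nrm tau mu P N xi.

Definition good_path w :=
  deffuant_path E nrm tau mu (fun a s => N a s w) (fun s => xi s w).

Definition active_disagreement e x y s : set T :=
  [set w | e < nrm (xi s w x - xi s w y) <= tau].

(** Repeated rings of [e0] are allowed: the first one lowers the energy, and later ones cannot raise
    it. *)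
Definition lone_ring (e0 : {set V}) a : set nat :=
  if a == e0 then [set k | (0 < k)%N] else [set 0%N].

Definition only_rings e0 s : set T := \bigcap_(a in [set` E])
  [set w | lone_ring e0 a (N a (s + 1) w - N a s w)%N].

(* The minimum makes this bound the same for every edge e0 ringing alone. *)
Definition lone_ring_prob : R :=
  \prod_(a in E) Num.min (1 - expR (- 1)) (expR (- 1)).

Let min_prob_itv : 0 < Num.min (1 - expR (- 1)) (expR (- 1) : R) <= 1.
Proof.
have e1 : expR (- 1) < 1 :> R by rewrite expR_lt1 ltrN10.
by rewrite lt_min subr_gt0 e1 expR_gt0 ge_min (ltW e1) orbT.
Qed.

Lemma lone_ring_prob_gt0 : 0 < lone_ring_prob.
Proof.
by apply: prodr_gt0 => a _; case/andP: min_prob_itv.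
Qed.

Lemma coord_measurable_trajectory s x : 0 <= s ->
  coord_measurable (fun w => xi s w x).
Proof.
by move=> s0; apply: borel_coord_measurable; exact: (deffuant_measurable model).
Qed.

Lemma measurable_disagreement s x y : 0 <= s ->
  measurable_fun setT (fun w => nrm (xi s w x - xi s w y)).
Proof.
move=> s0; apply: measurable_is_norm => //.
by apply: coord_measurableB; exact: coord_measurable_trajectory.
Qed.

Lemma setI_lt_le (U : Type) (f : U -> R) e r :
  [set w | e < f w <= r] = ~` [set w | f w <= e] `&` [set w | f w <= r].
Proof.
apply/seteqP; split=> w /=; first by move=> /andP[+ ->]; rewrite ltNge => /negP.
by move=> [/negP + ->]; rewrite -ltNge => ->.
Qed.

Lemma measurable_active_disagreement e x y s : 0 <= s ->
  measurable (active_disagreement e x y s).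
Proof.
move=> s0; rewrite /active_disagreement setI_lt_le; apply: measurableI.
  apply: measurableC.
  by apply: measurable_le_cst; exact: measurable_disagreement.
by apply: measurable_le_cst; exact: measurable_disagreement.
Qed.

Lemma measurable_only_rings e0 s : 0 <= s -> measurable (only_rings e0 s).
Proof.
move=> s0; apply: fin_bigcap_measurable => // a aE.
have [mN _ _ _ _ _] := deffuant_clock model aE.
have := measurable_fun_subn (mN (s + 1) (addr_ge0 s0 ler01)) (mN s s0).
by move=> /(_ measurableT (lone_ring e0 a) I); rewrite setTI.
Qed.

Lemma le_measure_null A B D N0 : measurable A -> measurable B -> measurable D ->
  measurable N0 -> P N0 = 0%E -> A `<=` B `|` D `|` N0 ->
  (P A <= P B + P D)%E.
Proof.
move=> mA mB mD mN PN AB.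
have mBD : measurable (B `|` D) by exact: measurableU.
have mBDN : measurable (B `|` D `|` N0) by exact: measurableU.
apply: (@le_trans _ _ (P (B `|` D `|` N0))).
  by apply: le_measure; rewrite ?inE.
apply: (le_trans (measureU2 P mBD mN)).
by rewrite [X in (_ + X)%E]PN adde0; exact: measureU2.
Qed.

Lemma lone_ring_prob_le (t : nat -> R) K e0 :
  0 <= t 0%N -> {homo t : i j / (i <= j)%N >-> i <= j} ->
  (forall i, t i < t i.+1) -> t K.+1 - t K = 1 ->
  (lone_ring_prob%:E <=
    \prod_(a in E) P (increment N t a K @^-1` lone_ring e0 a))%E.
Proof.
move=> t0 t_mono t_lt tK.
rewrite (_ : (\prod_(a in E) _)%E = (\prod_(a in E)
    (if a == e0 then 1 - expR (- 1) else expR (- 1)))%:E).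
  rewrite lee_fin; apply: ler_prod => a _.
  case/andP: min_prob_itv => /ltW-> _ /=.
  by case: eqP => _; rewrite ge_min lexx ?orbT.
rewrite -prodEFin; apply: eq_bigr => a aE; rewrite /lone_ring.
case: eqP => _; first by rewrite (increment_gt0 model)// tK.
by rewrite (increment_pmf model)// tK expr0 fact0 invr1 !mul1r.
Qed.

(** Without collision before [s], the configuration at [s] is determined by the initial one and the
    word of the first [K] cells, which are independent of cell [K], the unit of time after [s]. The
    error made in this replacement vanishes as [K] grows. *)
Lemma active_then_rings e x y s : 0 < s ->
  (lone_ring_prob%:E * P (active_disagreement e x y s) <=
   P (active_disagreement e x y s `&` only_rings [set x; y]%SET s))%E.
Proof.
move=> s_gt0; apply/lee_addgt0Pr => r r0.
set Bad := active_disagreement _ _ _ _; set G := only_rings _ _.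
pose M : R := #|{: {set V} * {set V}}|%:R * s ^+ 2.
have M0 : 0 <= M by rewrite mulr_ge0// sqr_ge0.
(* The collision probability M / K is paid twice, to pass from [Bad] to the event [A] on the word
   and back, so 2 M / K has to be at most [r]. *)
pose K := (Num.bound (2 * M / r)).+1.
have K0 : (0 < K)%N by [].
have MK : 2 * (M / K%:R) <= r.
  rewrite mulrA ler_pdivrMr ?ltr0n// [r * _]mulrC -ler_pdivrMr//.
  have := archi_boundP (divr_ge0 (mulr_ge0 (ler0n _ 2) M0) (ltW r0)).
  by move=> /ltW/le_trans; apply; rewrite ler_nat.
pose t := uniform_grid s K.
have t0 : 0 <= t 0%N by rewrite /t uniform_grid0.
have t_mono := uniform_grid_mono s_gt0 K0.
have t_lt := uniform_grid_ltS s_gt0 K0.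
have [mcol Pcol] := collision_prob model t0 t_mono t_lt
  (divr_ge0 (ltW s_gt0) (ler0n _ K)) (@uniform_grid_step _ s K).
have {}Pcol : (P (collision E N t K) <= (M / K%:R)%:E)%E.
  apply: (le_trans Pcol); rewrite lee_fin /M le_eqVlt; apply/orP; left; apply/eqP.
  by field; rewrite pnatr_eq0.
have [N0 [mN0 PN0 badN0]] := deffuant_dynamics model.
pose F (u : K.-tuple {set {set V}}) : set T := [set w |
  e < nrm (evolve nrm tau mu u (xi 0 w) x - evolve nrm tau mu u (xi 0 w) y) <= tau].
have mF u : initial_sigma xi (F u).
  (* With [T] carrying the sigma-algebra generated by the initial opinions, the general
     measurability lemmas give membership in [initial_sigma]. *)
  pose G0 := \bigcup_(z in [set: V])
    g_sigma_algebra_preimage (fun w => xi 0 w z : borel_rV R d).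
  have coord_initial z :
      coord_measurable ((fun w => xi 0 w z) : g_sigma_algebraType G0 -> _).
    apply: borel_coord_measurable.
    by apply: (measurable_fun_generated (f := fun z w => xi 0 w z : borel_rV R d)).
  have mev := coord_measurable_evolve tau mu nrmP u coord_initial.
  have mdist := measurable_is_norm nrmP (coord_measurableB (mev x) (mev y)).
  suff : measurable (F u : set (g_sigma_algebraType G0)) by [].
  rewrite /F setI_lt_le; apply: measurableI; last exact: measurable_le_cst.
  by apply: measurableC; exact: measurable_le_cst.
pose A := [set w | F (word E N t K w) w].
have mA : measurable A by exact: (measurable_word_event model).
have sameA w : ~ N0 w -> ~ collision E N t K w -> A w <-> Bad w.
  move=> wN0 /collision_freeP free.
  have good : good_path w by apply: contrapT => ?; apply: wN0; exact: badN0.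
  have := trajectory_evolve model E_simple (uniform_grid0 s K) t_mono good free.
  by rewrite uniform_gridK// /A /Bad /F /active_disagreement /= => ->.
have mBad : measurable Bad by apply: measurable_active_disagreement; exact: ltW.
have mG : measurable G by apply: measurable_only_rings; exact: ltW.
have GE : G = \bigcap_(a in [set` E])
    (increment N t a K @^-1` lone_ring [set x; y]%SET a).
  by apply: eq_bigcapr => a _; apply/seteqP; split=> w;
    rewrite /increment /= /t uniform_gridK// uniform_gridSK.
have PBad : (P Bad <= P A + P (collision E N t K))%E.
  apply: (le_measure_null _ _ _ mN0 PN0) => // w Bw.
  have [?|wN0] := pselect (N0 w); first by right.
  have [?|wc] := pselect (collision E N t K w); first by left; right.
  by left; left; apply/sameA.
have PAG : (P (A `&` G) <= P (Bad `&` G) + P (collision E N t K))%E.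
  apply: (le_measure_null _ _ _ mN0 PN0); [exact: measurableI|exact: measurableI|by []|].
  move=> w [Aw Gw].
  have [?|wN0] := pselect (N0 w); first by right.
  have [?|wc] := pselect (collision E N t K w); first by left; right.
  by left; left; split=> //; apply/sameA.
have PAGle : (lone_ring_prob%:E * P A <= P (A `&` G))%E.
  rewrite GE (past_future_independent model t0 t_mono (lone_ring [set x; y]%SET) mF).
  rewrite muleC lee_wpmul2l ?measure_ge0//; apply: lone_ring_prob_le => //.
  by rewrite /t uniform_gridSK uniform_gridK// addrAC subrr add0r.
have p1 : lone_ring_prob <= 1.
  by apply: prodr_ile1 => a _; case/andP: min_prob_itv => /ltW-> ->.
have p0 := lone_ring_prob_gt0.
have : (lone_ring_prob%:E * P Bad <= lone_ring_prob%:E * P A + (M / K%:R)%:E)%E.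
  apply: (@le_trans _ _ (lone_ring_prob%:E * (P A + (M / K%:R)%:E))%E).
    by apply: lee_wpmul2l; [rewrite lee_fin ltW|apply: (le_trans PBad); exact: leeD2l].
  rewrite ge0_muleDr ?measure_ge0 ?lee_fin ?divr_ge0//; apply: leeD2l.
  by rewrite -EFinM lee_fin ler_piMl ?divr_ge0.
move=> /le_trans; apply.
apply: (@le_trans _ _ (P (Bad `&` G) + (M / K%:R)%:E + (M / K%:R)%:E)%E).
  apply: leeD2r; apply: (le_trans PAGle); apply: (le_trans PAG); exact: leeD2l.
by rewrite -addeA -EFinD; apply: leeD2l; rewrite lee_fin; lra.
Qed.

End isolated_ring.

(** * Decrease of the mean energy *)

Lemma bounded_set_coord (R : realType) (d : nat) (D : set 'rV[R]_d) :
  bounded_set D -> exists M, forall v i, D v -> `|v 0 i| <= M.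
Proof.
move=> [M [_ hM]]; exists (M + 1) => v i Dv.
have : `|v| <= M + 1 by apply: hM => //; rewrite ltrDl.
apply: le_trans; rewrite /Num.norm/= mx_normrE.
exact: (le_bigmax _ (fun ij : 'I_1 * 'I_d => `|v ij.1 ij.2|) (0, i)).
Qed.

Lemma bounded_decrease_le0 (R : realType) (f : nat -> R) q :
  (forall n, 0 <= f n) -> (forall n, f n.+1 + q <= f n) -> q <= 0.
Proof.
move=> f0 fq; rewrite leNgt; apply/negP => q0.
have fn n : f n <= f 0%N - n%:R * q.
  elim: n => [|n IHn]; first by rewrite mul0r subr0.
  by have := fq n; rewrite -natr1; lra.
have := archi_boundP (divr_ge0 (f0 0%N) (ltW q0)); rewrite ltr_pdivrMr//.
by have := fn (Num.bound (f 0%N / q)); have := f0 (Num.bound (f 0%N / q)); lra.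
Qed.

Section energy.
Context (R : realType) (d : nat) (V : finType).
Variables (E : {set {set V}}) (Delta : set 'rV[R]_d) (nrm : 'rV[R]_d -> R).
Variables (tau mu : R).
Context (disp : measure_display) (T : measurableType disp).
Variables (P : probability T R) (N : {set V} -> R -> T -> nat).
Variable xi : R -> T -> V -> 'rV[R]_d.
Hypothesis nrmP : is_norm nrm.
Hypothesis E_simple : simple_graph E.
Hypothesis Delta_bounded : bounded_set Delta.
Hypotheses (mu0 : 0 < mu) (mu_half : mu <= 1 / 2).
Hypothesis model : deffuant_model E Delta nrm tau mu P N xi.

Local Notation good_path := (good_path E nrm tau mu N xi).
Local Notation active_disagreement := (active_disagreement nrm tau xi).
Local Notation only_rings := (only_rings E N).

Lemma edge_neq x y : [set x; y]%SET \in E -> x != y.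
Proof. by move=> /E_simple; rewrite cards2; case: eqP. Qed.

Lemma good_path_invariant (I : (V -> 'rV[R]_d) -> Prop) w s t : good_path w ->
  (forall x y eta, x != y -> [set x; y]%SET \in E -> I eta ->
     I (deffuant_update nrm tau mu x y eta)) ->
  0 <= s -> s <= t -> I (xi s w) -> I (xi t w).
Proof.
move=> path_w Iupd; apply: (trajectory_invariant (n := fun a s => N a s w)
  (xi := fun s => xi s w) E_simple _ path_w Iupd).
by move=> r; exact: (deffuant_right_continuous model).
Qed.

Lemma spread_le_mono r w s t : good_path w -> 0 <= s -> s <= t ->
  spread_le nrm r (xi s w) -> spread_le nrm r (xi t w).
Proof.
move=> path_w; apply: good_path_invariant path_w _ => x y eta _ _.
exact: spread_le_update.
Qed.

Lemma sum_dist_mono p w t : good_path w -> 0 <= t ->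
  \sum_z nrm (xi t w z - p) <= \sum_z nrm (xi 0 w z - p).
Proof.
move=> path_w t0.
apply: (good_path_invariant (I := fun eta => \sum_z nrm (eta z - p) <=
  \sum_z nrm (xi 0 w z - p)) path_w _ (lexx 0) t0 (lexx _)) => x y eta xy _.
by apply: le_trans; exact: sum_dist_update.
Qed.

Lemma energy_mono w s t : good_path w -> 0 <= s -> s <= t ->
  energy (xi t w) <= energy (xi s w).
Proof.
move=> path_w s0 st.
apply: (good_path_invariant (I := fun eta => energy eta <= energy (xi s w))
  path_w _ s0 st (lexx _)) => x y eta xy _.
by apply: le_trans; exact: energy_update_le.
Qed.

(** The first ring after [s] updates the disagreeing pair as it was at time [s], and then the energy
    does not increase up to [s + 1]. *)
Lemma energy_drop e : 0 < e -> exists2 k, 0 < k &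
  forall w s x y, good_path w -> 0 <= s -> [set x; y]%SET \in E ->
  energy (xi (s + 1) w) +
    k * \1_(active_disagreement e x y s `&` only_rings [set x; y]%SET s) w
  <= energy (xi s w).
Proof.
move=> /(is_norm_sqr_lower_bound nrmP)[k k0 hk].
have rate0 : 0 < 2 * mu * (1 - mu).
  by move: mu0 mu_half => ? ?; rewrite !mulr_gt0//; lra.
(* Here [k] bounds the squared Euclidean distance of two opinions that are [e] apart in [nrm], and
   the other factor comes from [energy_update]. *)
exists (2 * mu * (1 - mu) * k); first by rewrite mulr_gt0.
move=> w s x y path_w s0 xyE; have s1 : s <= s + 1 by rewrite lerDl.
rewrite indicE; case: (boolP (w \in _)) => [|_]; last first.
  by rewrite mulr0 addr0; exact: energy_mono.
rewrite inE mulr1 => -[/andP[/ltW/hk dist le_tau] rings].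
have nm a (aE : a \in E) := clock_mono model w aE.
have nr a (aE : a \in E) := clock_right model w aE.
have xi_right r := deffuant_right_continuous model w (t := r).
have [||u [su us _ _ xiu]] := trajectory_first_update (n := fun a s => N a s w)
  (xi := fun s => xi s w) nm nr xi_right path_w s0 s1 xyE.
- by have := rings _ xyE; rewrite /lone_ring eqxx /= subn_gt0.
- move=> b bE bxy; apply/eqP; rewrite eqn_leq nm//=.
  by have := rings _ bE; rewrite /lone_ring (negbTE bxy) /= => /eqP; rewrite subn_eq0.
have := energy_mono path_w (le_trans s0 (ltW su)) us; rewrite xiu.
rewrite energy_update ?edge_neq// le_tau mulr1.
move: dist => /(ler_wpM2l (ltW rate0)); lra.
Qed.

Lemma measurable_energy s : 0 <= s -> measurable_fun setT (fun w => energy (xi s w)).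
Proof.
move=> s0; apply: measurable_sum => x; apply: measurable_sum => i.
apply: measurable_funX; exact: (coord_measurable_trajectory model).
Qed.

Lemma energy_ge0 (eta : V -> 'rV[R]_d) : 0 <= energy eta.
Proof. by apply: sumr_ge0 => x _; apply: sumr_ge0 => i _; rewrite sqr_ge0. Qed.

Lemma energy_bounded : exists M, forall s w, 0 <= s -> energy (xi s w) <= M.
Proof.
have [M hM] := bounded_set_coord Delta_bounded.
exists (\sum_(x in V) \sum_(i < d) M ^+ 2) => s w s0.
apply: ler_sum => x _; apply: ler_sum => i _.
rewrite -real_normK ?num_real// ler_sqr ?nnegrE//.
  by apply: hM; exact: (deffuant_state model).
by apply: le_trans (hM (xi s w x) i _); last exact: (deffuant_state model).
Qed.

(** A real number, so that differences can be formed; the integral is finite at times s >= 0 because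
    opinions are bounded. *)
Definition mean_energy s : R := fine (\int[P]_w (energy (xi s w))%:E).

Lemma mean_energyE s : 0 <= s ->
  (mean_energy s)%:E = (\int[P]_w (energy (xi s w))%:E)%E.
Proof.
move=> s0; rewrite fineK// ge0_fin_numE; last first.
  by apply: integral_ge0 => w _; rewrite lee_fin energy_ge0.
have [M hM] := energy_bounded.
apply: (@le_lt_trans _ _ (\int[P]_w (cst M%:E w))%E).
  apply: ge0_le_integral => //=.
  - by move=> w _; rewrite lee_fin energy_ge0.
  - by apply/measurable_EFinP; exact: measurable_energy.
  - by move=> w _; rewrite lee_fin hM.
by rewrite integral_cst//= [X in (_ * X)%E]probability_setT mule1 ltry.
Qed.

Lemma mean_energy_ge0 s : 0 <= mean_energy s.
Proof.
by apply: fine_ge0; apply: integral_ge0 => w _; rewrite lee_fin energy_ge0.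
Qed.

Lemma mean_energy_drop e : 0 < e -> exists2 C, 0 < C &
  forall s x y, 0 < s -> [set x; y]%SET \in E ->
  (P (active_disagreement e x y s) <=
    (C * (mean_energy s - mean_energy (s + 1)))%:E)%E.
Proof.
move=> /energy_drop[k k0 hk].
have p0 := lone_ring_prob_gt0 R E.
(* A disagreement is followed by a suitable ring with probability at least [lone_ring_prob], and
   then costs energy [k]. *)
exists ((lone_ring_prob R E * k)^-1); first by rewrite invr_gt0 mulr_gt0.
move=> s x y s_gt0 xyE; have s0 := ltW s_gt0.
have s10 : 0 <= s + 1 by rewrite addr_ge0.
set B := active_disagreement e x y s; set G := only_rings [set x; y]%SET s.
have mB : measurable B by exact: (measurable_active_disagreement nrmP model).
have mBG : measurable (B `&` G).
  by apply: measurableI => //; exact: (measurable_only_rings model).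
have key : ((mean_energy (s + 1))%:E + k%:E * P (B `&` G) <= (mean_energy s)%:E)%E.
  rewrite !mean_energyE// -(setIT (B `&` G)) -integral_indic//.
  rewrite -ge0_integralZl//; last 2 first.
  - by apply/measurable_EFinP; exact: measurable_indic.
  - by rewrite lee_fin ltW.
  rewrite -ge0_integralD//; last 4 first.
  - by move=> w _; rewrite lee_fin energy_ge0.
  - by apply/measurable_EFinP; exact: measurable_energy.
  - by move=> w _; rewrite -EFinM lee_fin; apply: mulr_ge0 => //; exact: ltW.
  - by apply/measurable_EFinP; apply: measurable_funM => //; exact: measurable_indic.
  (* The energy drops only along good paths, hence almost everywhere. *)
  apply: ae_ge0_le_integral => //.
  - by move=> w _; rewrite -EFinM -EFinD lee_fin addr_ge0 ?energy_ge0//;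
      apply: mulr_ge0 => //; exact: ltW.
  - apply/measurable_EFinP; apply: measurable_funD; first exact: measurable_energy.
    by apply: measurable_funM => //; exact: measurable_indic.
  - by move=> w _; rewrite lee_fin energy_ge0.
  - by apply/measurable_EFinP; exact: measurable_energy.
  have := deffuant_dynamics model; apply: filterS => w path_w _.
  by rewrite -EFinM -EFinD lee_fin hk.
have := active_then_rings nrmP E_simple model e x y s_gt0; rewrite -/B -/G.
have finP A : measurable A -> P A = (fine (P A))%:E.
  by move=> mA; rewrite fineK// fin_num_measure.
move: key; rewrite (finP _ mB) (finP _ mBG) -!EFinM -EFinD !lee_fin => key pB.
rewrite -(ler_pM2l (mulr_gt0 p0 k0)) mulrA divff ?mul1r ?lt0r_neq0 ?mulr_gt0//.
by move: pB => /(ler_wpM2l (ltW k0)); lra.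
Qed.

Definition some_active_disagreement e s : set T := \big[setU/set0]_(p : V * V |
  [set p.1; p.2]%SET \in E) active_disagreement e p.1 p.2 s.

(** Each unit of time lowers a multiple [f] of the mean energy by at least the probability of [A].
    As [f] stays nonnegative, this probability is 0. *)
Lemma persistent_disagreement_null e A : 0 < e -> measurable A ->
  (forall n : nat, A `<=` some_active_disagreement e n.+1%:R) -> P A = 0%E.
Proof.
move=> /mean_energy_drop[C C0 hC] mA Asub.
(* Without edges [A] is empty; otherwise an edge serves to show that the bound [r] below is
   nonnegative. *)
have [E0|[a aE]] := set_0Vmem E.
  have := Asub 0%N; rewrite /some_active_disagreement big_pred0.
    by rewrite subset0 => ->; rewrite measure0.
  by move=> p; rewrite E0 finset.in_set0.
have PA_fin : P A = (fine (P A))%:E by rewrite fineK// fin_num_measure.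
pose f n : R := #|{: V * V}|%:R * (C * mean_energy n.+1%:R).
have drop n : f n.+1 + fine (P A) <= f n.
  have n0 : 0 < n.+1%:R :> R by rewrite ltr0n.
  pose r := C * (mean_energy n.+1%:R - mean_energy (n.+1%:R + 1)).
  have r0 : 0 <= r.
    have /eqP/cards2P[x [y [_ axy]]] := E_simple aE.
    rewrite axy in aE; rewrite -lee_fin; apply: le_trans (hC _ _ _ n0 aE).
    exact: measure_ge0.
  have mdis (p : V * V) : measurable (active_disagreement e p.1 p.2 n.+1%:R).
    exact: (measurable_active_disagreement nrmP model).
  have [mU PU] := @finite_union_bound _ _ _ P (V * V)%type
    (fun p => [set p.1; p.2]%SET \in E)
    (fun p => active_disagreement e p.1 p.2 n.+1%:R) r r0 (fun p _ => mdis p)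
    (fun p pE => hC _ _ _ n0 pE).
  have : (P A <= (#|{: V * V}|%:R * r)%:E)%E.
    by apply: le_trans PU; apply: le_measure; rewrite ?inE//; exact: Asub.
  by rewrite PA_fin lee_fin /f /r natr1; lra.
apply/eqP; rewrite eq_le measure_ge0 andbT PA_fin lee_fin.
apply: (bounded_decrease_le0 _ drop) => n.
by rewrite /f mulr_ge0// mulr_ge0 ?mean_energy_ge0// ltW.
Qed.

End energy.

(** * Consensus *)

Section connectivity.
Context (R : realType) (d : nat) (V : finType).
Variables (E : {set {set V}}) (nrm : 'rV[R]_d -> R) (tau : R).
Hypothesis nrmP : is_norm nrm.
Hypothesis E_connected : connected_graph E.

Lemma exists_le_mean (f : V -> R) r : (0 < #|V|)%N ->
  \sum_x f x <= #|V|%:R * r -> exists x, f x <= r.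
Proof.
move=> V0 fr; apply: contrapT => none.
have lt_r x : r < f x by rewrite ltNge; apply/negP => ?; apply: none; exists x.
suff : #|V|%:R * r < \sum_x f x by rewrite ltNge fr.
rewrite mulr_natl -sumr_const; case/card_gt0P: V0 => x0 _.
rewrite (bigD1 x0)//= [ltRHS](bigD1 x0)//= ltr_leD// ler_sum// => x _.
exact: ltW.
Qed.

(* A vertex within tau - r of the center agrees with every opinion at distance
   at most r from the center, so agreement propagates along paths; e is the
   room left for the drift of at most e / (2 |V|) per edge. *)
Lemma spread_le_of_compatible (eta : V -> 'rV[R]_d) c r e : 0 < e ->
  (forall x, nrm (eta x - c) <= r) ->
  \sum_x nrm (eta x - c) <= #|V|%:R * (tau - r - e) ->
  (forall x y, [set x; y]%SET \in E ->
    nrm (eta x - eta y) <= tau -> nrm (eta x - eta y) <= e / (2 * #|V|%:R)) ->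
  spread_le nrm e eta.
Proof.
move=> e0 eta_r sum_le compat y1 y2.
have V0 : (0 < #|V|)%N by apply/card_gt0P; exists y1.
have V0' : 0 < #|V|%:R :> R by rewrite ltr0n.
set dl := e / (2 * #|V|%:R) in compat.
have dl0 : 0 < dl by rewrite divr_gt0// mulr_gt0.
have dlV : #|V|%:R * dl = e / 2.
  by rewrite /dl; field; rewrite lt0r_neq0.
have [x0 hx0] := exists_le_mean V0 sum_le.
have along z p j : path (fun u v : V => [set u; v]%SET \in E) z p ->
    (j + size p <= #|V|)%N -> nrm (eta z - eta x0) <= j%:R * dl ->
    nrm (eta (last z p) - eta x0) <= (j + size p)%:R * dl.
  elim: p z j => [|z' p IHp] z j /=; first by rewrite addn0.
  move=> /andP[zz' pp] jp zj; rewrite addnS -addSn; apply: IHp => //.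
    by rewrite addSn -addnS.
  have jdl : j%:R * dl <= e / 2.
    by rewrite -dlV ler_pM2r// ler_nat (leq_trans _ jp)// leq_addr.
  have zc := is_norm_dist_trans nrmP (eta z) (eta x0) c.
  have zz := is_norm_dist_trans nrmP (eta z) c (eta z').
  have z'c := eta_r z'; rewrite (is_norm_distC nrmP) in z'c.
  have : nrm (eta z - eta z') <= dl by apply: compat => //; lra.
  rewrite (is_norm_distC nrmP) => z'z.
  have := is_norm_dist_trans nrmP (eta z') (eta z) (eta x0).
  by rewrite -natr1 mulrDl mul1r; lra.
have near_x0 y : nrm (eta y - eta x0) <= e / 2.
  have /connectP[p pp ->] := E_connected x0 y.
  (* A path without repeated vertices has fewer than |V| edges, so the total drift is at most e /
     2. *)
  case/shortenP: pp => p' pp' up' _.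
  have szp : (size p' < #|V|)%N.
    by have := max_card (mem (x0 :: p')); rewrite (card_uniqP up').
  have := along x0 p' 0%N pp' (ltnW szp).
  rewrite subrr (is_norm0 nrmP) mul0r lexx add0n => /(_ isT)/le_trans; apply.
  by rewrite -dlV ler_pM2r// ler_nat ltnW.
have := is_norm_dist_trans nrmP (eta y1) (eta x0) (eta y2).
have := near_x0 y1; have := near_x0 y2.
by rewrite (is_norm_distC nrmP (eta y2)); lra.
Qed.

End connectivity.

Section diameter.
Context (R : realType) (d : nat) (V : finType) (nrm : 'rV[R]_d -> R).
Hypothesis nrmP : is_norm nrm.

Definition spread (eta : V -> 'rV[R]_d) : R :=
  sup [set nrm (eta x - eta y) | x in setT & y in setT].

Let dist_le_spread (eta : V -> 'rV[R]_d) x y : nrm (eta x - eta y) <= spread eta.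
Proof.
apply: ub_le_sup; last by exists x => //; exists y.
exists (\sum_x \sum_y nrm (eta x - eta y)) => _ [u _ [v _ <-]].
rewrite (bigD1 u)//= (bigD1 v)//= -addrA lerDl addr_ge0// sumr_ge0// => *.
  exact: is_norm_ge0.
by apply: sumr_ge0 => *; exact: is_norm_ge0.
Qed.

Lemma spreadP (eta : V -> 'rV[R]_d) r : 0 <= r ->
  spread eta <= r <-> spread_le nrm r eta.
Proof.
move=> r0; split=> [le_r x y|le_r]; first exact: le_trans le_r.
rewrite /spread; set A := (X in sup X).
(* Without vertices [sup] takes its default value 0, which is covered by 0 <= r. *)
have [->|A0] := eqVneq A set0; first by rewrite sup0.
by apply: ge_sup; [exact/set0P|move=> _ [u _ [v _ <-]]; exact: le_r].
Qed.

Lemma spread_ge0 (eta : V -> 'rV[R]_d) : 0 <= spread eta.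
Proof.
have [V0|/card_gt0P[x _]] := posnP #|V|; last first.
  by apply: le_trans (dist_le_spread eta x x); exact: is_norm_ge0.
rewrite /spread (_ : [set _ | _ in _ & _ in _] = set0) ?sup0//.
by apply/seteqP; split=> // r [x _ _]; have := fintype0 x V0.
Qed.

(** Boundedness in coordinates bounds the distances in [nrm], so that [sup] is an actual upper
    bound. *)
Lemma dist_center_le (Delta : set 'rV[R]_d) c a : bounded_set Delta ->
  is_center nrm Delta c -> Delta a -> nrm (a - c) <= diameter nrm Delta / 2.
Proof.
move=> /bounded_set_coord[M hM] [Dc <-] Da.
apply: ub_le_sup; last by exists a.
have [C C0 hC] := is_norm_le_l1 nrmP.
exists (C * \sum_(i < d) (M + M)) => _ [b Db <-].
apply: le_trans (hC _) _; rewrite ler_pM2l//; apply: ler_sum => i _.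
by rewrite !mxE; apply: le_trans (ler_normB _ _) _; rewrite lerD ?hM.
Qed.

End diameter.

Section consensus.
Context (R : realType) (d : nat) (V : finType).
Variables (E : {set {set V}}) (Delta : set 'rV[R]_d) (nrm : 'rV[R]_d -> R).
Variables (tau mu : R).
Context (disp : measure_display) (T : measurableType disp).
Variables (P : probability T R) (N : {set V} -> R -> T -> nat).
Variable xi : R -> T -> V -> 'rV[R]_d.
Hypothesis nrmP : is_norm nrm.
Hypothesis model : deffuant_model E Delta nrm tau mu P N xi.

(** Restricting to rational times writes the event with countable operations only, whence its
    measurability. *)
Lemma consensusP w : consensus nrm xi w <->
  forall k : nat, exists n : nat, forall q : rat, n%:R <= ratr q :> R ->
    spread_le nrm k.+1%:R^-1 (xi (ratr q) w).
Proof.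
split=> [/cvgrPdist_le cvg0 k|cvg].
  have k0 : 0 < k.+1%:R^-1 :> R by rewrite invr_gt0 ltr0n.
  have [M [_ hM]] := cvg0 _ k0.
  exists (Num.bound `|M|) => q nq; apply/(spreadP nrmP); first exact: ltW.
  have := hM (ratr q); rewrite /= sub0r normrN ger0_norm ?spread_ge0//.
  apply; apply: lt_le_trans nq; apply: le_lt_trans (ler_norm M) _.
  exact: archi_boundP.
apply/cvgrPdist_le => e e0.
have [k ke] : exists k : nat, k.+1%:R^-1 <= e.
  exists (Num.bound e^-1); rewrite invf_ple ?posrE ?ltr0n//.
  apply: ltW; apply: lt_le_trans (archi_boundP _) _; last by rewrite ler_nat.
  by rewrite invr_ge0 ltW.
have [n hn] := cvg k.
exists n%:R; split=> // t nt; rewrite /= sub0r normrN.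
have t0 : 0 <= t by rewrite (le_trans _ (ltW nt)).
(* The configuration at time [t] persists on some ]t, v[, so it is seen at a rational time. *)
have [v tv hv] := near_right_ex (deffuant_right_continuous model w t0).
have [q /itvP qtv] := rat_in_itvoo tv.
have tq : t < ratr q by rewrite qtv.
have /(spreadP nrmP) sp := hn q (ltW (lt_trans nt tq)).
rewrite ger0_norm; last exact: (@spread_ge0 _ _ _ _ nrmP).
rewrite -(hv (ratr q)) ?qtv//; apply: le_trans ke; apply: sp.
by rewrite invr_ge0.
Qed.

Lemma measurable_spread_le r s : 0 <= s ->
  measurable [set w | spread_le nrm r (xi s w)].
Proof.
move=> s0; rewrite (_ : [set w | _] =
  \bigcap_(x in [set: V]) \bigcap_(y in [set: V])
    [set w | nrm (xi s w x - xi s w y) <= r]); last first.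
  by apply/seteqP; split=> w /= h x; [move=> _ y _|move=> y]; exact: h.
apply: fin_bigcap_measurable => // x _; apply: fin_bigcap_measurable => // y _.
by apply: measurable_le_cst; exact: (measurable_disagreement nrmP model).
Qed.

Lemma measurable_consensus : measurable (consensus nrm xi).
Proof.
rewrite (_ : consensus nrm xi = \bigcap_k \bigcup_n \bigcap_(q in [set: rat])
  [set w | n%:R <= ratr q :> R -> spread_le nrm k.+1%:R^-1 (xi (ratr q) w)]);
  last first.
  apply/seteqP; split=> w.
    move=> /consensusP cvg k _; have [n hn] := cvg k.
    by exists n => // q _; exact: hn.
  by move=> h; apply/consensusP => k; have [n _ hn] := h k I; exists n => q; exact: hn.
apply: bigcap_measurable => // k _; apply: bigcupT_measurable => n.
rewrite -[X in measurable X]setCK setC_bigcap; apply: measurableC.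
apply: countable_bigcupT_measurable => // q; apply: measurableC.
have [nq|nq] := boolP (n%:R <= ratr q :> R).
  rewrite (_ : [set w | _] = [set w | spread_le nrm k.+1%:R^-1 (xi (ratr q) w)]).
    by apply: measurable_spread_le; exact: le_trans nq.
  by apply/seteqP; split=> w //= h; exact: h.
by rewrite (_ : [set w | _] = setT)//; apply/seteqP; split.
Qed.

End consensus.

(** * Probability of consensus *)

Section initial_configuration.
Context (R : realType) (d : nat) (V : finType).
Variables (E : {set {set V}}) (Delta : set 'rV[R]_d) (nrm : 'rV[R]_d -> R).
Variables (tau mu : R).
Context (disp : measure_display) (T : measurableType disp).
Variables (P : probability T R) (N : {set V} -> R -> T -> nat).
Variable xi : R -> T -> V -> 'rV[R]_d.
Hypothesis nrmP : is_norm nrm.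
Hypothesis model : deffuant_model E Delta nrm tau mu P N xi.
Context (disp' : measure_display) (T' : measurableType disp').
Variables (Q : probability T' R) (X : {RV Q >-> borel_rV R d}).
Hypothesis copies : iid_copies P (xi 0) Q X.
Variable c : 'rV[R]_d.

Definition total_dist w : R := \sum_x nrm (xi 0 w x - c).

Let measurable_dist x : measurable_fun setT (fun w => nrm (xi 0 w x - c)).
Proof.
apply: measurable_is_norm => //; apply: coord_measurableB.
  exact: (coord_measurable_trajectory model).
exact: coord_measurable_cst.
Qed.

Lemma measurable_total_dist : measurable_fun setT total_dist.
Proof. by apply: measurable_sum => x; exact: measurable_dist. Qed.

Lemma mean_dist_copy x :
  (\int[P]_w (nrm (xi 0 w x - c))%:E =
   \int[Q]_w (nrm ((X w : 'rV[R]_d) - c))%:E)%E.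
Proof.
pose f : T -> borel_rV R d := fun w => xi 0 w x.
pose g : borel_rV R d -> \bar R := fun v => (nrm ((v : 'rV[R]_d) - c))%:E.
have mf : measurable_fun setT f by exact: (deffuant_measurable model).
have mX : measurable_fun setT (X : T' -> borel_rV R d) by exact: measurable_funPT.
have mg : measurable_fun setT g.
  apply/measurable_EFinP; apply: measurable_is_norm => //.
  apply: coord_measurableB; last exact: coord_measurable_cst.
  exact: borel_coord_measurable.
have g0 v : setT v -> (0 <= g v)%E by move=> _; rewrite lee_fin is_norm_ge0.
have := ge0_integral_pushforward mf P measurableT mg.
have := ge0_integral_pushforward mX Q measurableT mg.
rewrite !preimage_setT => /(_ (fun v _ => g0 v I)) <- /(_ (fun v _ => g0 v I)) <-.
apply: eq_measure_integral => B mB _.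
by rewrite /pushforward; exact: copies.2.
Qed.

(** Markov's inequality: by equality of laws the mean of the total distance is |V| times that of one
    copy, and |V| cancels. *)
Lemma total_dist_markov r : 0 < r -> (0 < #|V|)%N ->
  (r%:E * P [set w | (#|V|%:R * r <= total_dist w)%R] <=
   \int[Q]_w (nrm ((X w : 'rV[R]_d) - c))%:E)%E.
Proof.
move=> r0 V0; set B := [set w | _].
have V0' : 0 < #|V|%:R :> R by rewrite ltr0n.
have mB : measurable B by apply: measurable_ge_cst; exact: measurable_total_dist.
have dist0 w x : 0 <= nrm (xi 0 w x - c) by exact: is_norm_ge0.
have total : (\int[P]_w (total_dist w)%:E =
    #|V|%:R%:E * \int[Q]_w (nrm ((X w : 'rV[R]_d) - c))%:E)%E.
  transitivity (\int[P]_w (\sum_(x in V) (nrm (xi 0 w x - c))%:E))%E.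
    by apply: eq_integral => w _; rewrite /total_dist -sumEFin.
  rewrite ge0_integral_sum//; last 2 first.
  - by move=> x; apply/measurable_EFinP; exact: measurable_dist.
  - by move=> x w _; rewrite lee_fin.
  under eq_bigr do rewrite mean_dist_copy.
  by rewrite sumr_const mule_natl.
rewrite -(@lee_pmul2l _ #|V|%:R%:E)// ?lte_fin//.
rewrite -total muleA -EFinM -[X in (_ * P X)%E]setIT -integral_indic//.
rewrite -ge0_integralZl//; last 2 first.
- by apply/measurable_EFinP; exact: measurable_indic.
- by rewrite lee_fin mulr_ge0 ?ltW.
apply: ge0_le_integral => //.
- by move=> w _; rewrite -EFinM lee_fin; apply: mulr_ge0 => //; rewrite mulr_ge0 ?ltW.
- by apply/measurable_EFinP; apply: measurable_funM => //; exact: measurable_indic.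
- by apply/measurable_EFinP; exact: measurable_total_dist.
move=> w _; rewrite -EFinM lee_fin indicE.
case: (boolP (w \in B)) => [|_]; first by rewrite inE mulr1.
by rewrite mulr0 sumr_ge0.
Qed.

End initial_configuration.

Section main.
Context (R : realType) (d : nat) (V : finType).
Variables (E : {set {set V}}) (Delta : set 'rV[R]_d) (nrm : 'rV[R]_d -> R).
Variables (tau mu : R).
Context (disp : measure_display) (T : measurableType disp).
Variables (P : probability T R) (N : {set V} -> R -> T -> nat).
Variable xi : R -> T -> V -> 'rV[R]_d.
Hypothesis nrmP : is_norm nrm.
Hypothesis E_simple : simple_graph E.
Hypothesis E_connected : connected_graph E.
Hypothesis Delta_bounded : bounded_set Delta.
Hypotheses (mu0 : 0 < mu) (mu_half : mu <= 1 / 2).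
Hypothesis model : deffuant_model E Delta nrm tau mu P N xi.
Variable c : 'rV[R]_d.
Hypothesis c_center : is_center nrm Delta c.

Local Notation theta := (tau - diameter nrm Delta / 2).

(** The exceptional event, to be shown null. Times start at 1 because the estimate on disagreements
    is for positive times. *)
Definition stuck e : set T :=
  [set w | total_dist nrm xi c w <= #|V|%:R * (theta - e)] `&`
  \bigcap_n [set w | ~ spread_le nrm e (xi n.+1%:R w)].

Lemma measurable_stuck e : measurable (stuck e).
Proof.
apply: measurableI.
  by apply: measurable_le_cst; exact: (measurable_total_dist nrmP model).
apply: bigcapT_measurable => n; apply: measurableC.
exact: (measurable_spread_le nrmP model).
Qed.

(** Off the null set [N0] of bad paths, if at some time [n.+1] no edge had a disagreement in ]e / (2
    |V|), tau], the spread would be at most [e]. So a stuck path has an active disagreement at each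
    of these times. *)
Lemma stuck_null e : 0 < e -> (0 < #|V|)%N -> P (stuck e) = 0%E.
Proof.
move=> e0 V0; have [N0 [mN0 PN0 badN0]] := deffuant_dynamics model.
have mS := measurable_stuck e.
apply/eqP; rewrite eq_le measure_ge0 andbT.
rewrite -[leRHS]adde0 -[X in (_ <= _ + X)%E]PN0.
have SN0 : P (stuck e `\` N0) = 0%E.
  apply: (persistent_disagreement_null nrmP E_simple Delta_bounded mu0 mu_half
    model (e := e / (2 * #|V|%:R))).
  - by rewrite divr_gt0// mulr_gt0// ltr0n.
  - exact: measurableD.
  move=> n w [[dist_le /(_ n I) nospread] wN0].
  have path_w : good_path E nrm tau mu N xi w.
    by apply: contrapT => ?; apply: wN0; exact: badN0.
  apply: contrapT => noactive; apply: nospread.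
  have n0 : 0 <= n.+1%:R :> R by rewrite ler0n.
  apply: (spread_le_of_compatible nrmP E_connected
    (c := c) (r := diameter nrm Delta / 2) (tau := tau)) => //.
  - move=> x; apply: (dist_center_le nrmP Delta_bounded c_center).
    exact: (deffuant_state model).
  - apply: le_trans dist_le.
    exact: (sum_dist_mono nrmP E_simple mu0 mu_half model).
  move=> x y xyE le_tau; rewrite leNgt; apply/negP => lt_dist; apply: noactive.
  rewrite /some_active_disagreement -bigcup_seq_cond.
  exists (x, y); first by rewrite /= mem_index_enum.
  by rewrite /active_disagreement /= lt_dist.
rewrite -[X in (_ <= X + _)%E]SN0.
have mSN : measurable (stuck e `\` N0) by exact: measurableD.
apply: (@le_trans _ _ (P ((stuck e `\` N0) `|` N0))); last exact: measureU2.
apply: le_measure; rewrite ?inE//; first exact: measurableU.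
by move=> w Sw; have [?|?] := pselect (N0 w); [right|left].
Qed.

Lemma consensus_of_total_dist w : (0 < #|V|)%N ->
  good_path E nrm tau mu N xi w -> (forall k : nat, ~ stuck k.+1%:R^-1 w) ->
  total_dist nrm xi c w < #|V|%:R * theta -> consensus nrm xi w.
Proof.
move=> V0 path_w unstuck lt_theta; apply/(consensusP nrmP model) => k.
have V0' : 0 < #|V|%:R :> R by rewrite ltr0n.
pose gap := theta - total_dist nrm xi c w / #|V|%:R.
have gap0 : 0 < gap by rewrite subr_gt0 ltr_pdivrMr// mulrC.
(* At level 1 / (m + 1) the initial distances leave enough margin, and a spread that small is also
   below 1 / (k + 1). The spread reaches this level at some integer time and never grows again. *)
pose m := maxn k (Num.bound gap^-1).
have m_gap : m.+1%:R^-1 <= gap.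
  rewrite invf_ple ?posrE ?ltr0n//.
  apply: ltW; apply: lt_le_trans (archi_boundP _) _; first by rewrite invr_ge0 ltW.
  by rewrite ler_nat (leq_trans (leq_maxr k _)).
have mk : m.+1%:R^-1 <= k.+1%:R^-1 :> R.
  by rewrite lef_pV2 ?posrE ?ltr0n// ler_nat ltnS leq_maxl.
have /not_andP[dist_big|/existsNP[n /not_implyP[_ /contrapT sp]]] := unstuck m.
  exfalso; apply: dist_big => /=; rewrite mulrC -ler_pdivrMr//.
  by rewrite lerBrDr addrC -lerBrDr.
exists n.+1 => q nq.
have sp' : spread_le nrm k.+1%:R^-1 (xi n.+1%:R w).
  by move=> x y; apply: le_trans mk; exact: sp.
apply: (spread_le_mono nrmP E_simple mu0 mu_half model path_w _ nq sp').
exact: ler0n.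
Qed.

Lemma total_dist_ae_consensus : (0 < #|V|)%N ->
  (1 - P [set w | (#|V|%:R * theta <= total_dist nrm xi c w)%R]
    <= P (consensus nrm xi))%E.
Proof.
move=> V0; set B := [set w | _].
have mB : measurable B.
  by apply: measurable_ge_cst; exact: (measurable_total_dist nrmP model).
rewrite -probability_setC//.
have [N0 [mN0 PN0 badN0]] := deffuant_dynamics model.
have mC := measurable_consensus nrmP model.
pose S := \bigcup_k stuck k.+1%:R^-1.
have mS : measurable S by apply: bigcupT_measurable => k; exact: measurable_stuck.
have PS : P S = 0%E.
  apply/negligibleP => //; apply: negligible_bigcup => k.
  apply/negligibleP; first exact: measurable_stuck.
  by apply: stuck_null => //; rewrite invr_gt0 ltr0n.
rewrite -[leRHS]adde0 -[X in (_ <= _ + X)%E]PS.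
apply: (le_measure_null _ mC mS mN0 PN0); first exact: measurableC.
move=> w /negP; rewrite -ltNge => lt_theta.
have [?|wN0] := pselect (N0 w); first by right.
have [?|wS] := pselect (S w); first by left; right.
left; left; apply: consensus_of_total_dist => //.
  by apply: contrapT => ?; apply: wN0; exact: badN0.
by move=> k Sk; apply: wS; exists k.
Qed.

End main.

Theorem theorem1 (R : realType) (d : nat)
    (V : finType) (E : {set {set V}})
    (Delta : set 'rV[R]_d) (nrm : 'rV[R]_d -> R) (tau mu : R)
    (disp : measure_display) (T : measurableType disp) (P : probability T R)
    (N : {set V} -> R -> T -> nat) (xi : R -> T -> V -> 'rV[R]_d)
    (disp' : measure_display) (T' : measurableType disp')
    (Q : probability T' R) (X : {RV Q >-> borel_rV R d})
    (c : 'rV[R]_d)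
    (hsimple : simple_graph E) (hconn : connected_graph E)
    (hbounded : bounded_set Delta) (hconvex : convex_set Delta)
    (hnorm : is_norm nrm)
    (htau : 0 < tau) (hmu0 : 0 < mu) (hmu : mu <= 1 / 2)
    (hmodel : deffuant_model E Delta nrm tau mu P N xi)
    (hX : forall w, Delta (X w))
    (hiid : iid_copies P (xi 0) Q X)
    (hc : is_center nrm Delta c)
    (htau_diam : diameter nrm Delta / 2 < tau) :
  measurable (consensus nrm xi) /\
  (1 - 'E_Q[(fun w => nrm ((X w : 'rV[R]_d) - c)%R)]
         / (tau - diameter nrm Delta / 2)%R%:E
     <= P (consensus nrm xi))%E.
Proof.
split; first exact: (measurable_consensus hnorm hmodel).
have theta0 : 0 < tau - diameter nrm Delta / 2 by rewrite subr_gt0.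
rewrite unlock inver gt_eqF//; set m := (\int[Q]_w _)%E.
have m0 : (0 <= m)%E.
  by apply: integral_ge0 => w _; rewrite lee_fin is_norm_ge0.
(* Without vertices consensus is certain; otherwise the bound by the total distance applies. *)
have [V0|V0] := posnP #|V|.
  have -> : consensus nrm xi = setT.
    apply/seteqP; split=> // w _; apply/(consensusP hnorm hmodel) => k.
    exists 0%N => q _ x; exfalso.
    by have := fintype0 x V0.
  rewrite [leRHS]probability_setT -[leRHS]sube0 leeB// mule_ge0//.
  by rewrite lee_fin invr_ge0 ltW.
apply: (le_trans _ (total_dist_ae_consensus hnorm hsimple hconn hbounded
  hmu0 hmu hmodel hc V0)).
apply: leeB => //; rewrite lee_pdivlMr// muleC.
exact: (total_dist_markov hnorm hmodel hiid).
Qed.
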